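(* Let $a\in[0,\infty)$ and let $\alpha,m,n,l,r\in\mathbb{T}$ satisfy $|\operatorname{Im}_j(\alpha)|<\operatorname{Re}(\alpha)$, $|\operatorname{Im}_j(m)|<\operatorname{Re}(m)$ and $|\operatorname{Im}_j(n)|<\operatorname{Re}(n)$. Then for every real $x>a$: (1) $\left(\mathbb{I}_{a+}^{\alpha}\left[(t-a)^{n-1}\mathbb{E}_{m,n}^{l}\big(r(t-a)^{m}\big)\right]\right)(x)=(x-a)^{n+\alpha-1}\,\mathbb{E}_{m,n+\alpha}^{l}\big(r(x-a)^{m}\big)$; (2) $\left(\mathbb{D}_{a+}^{\alpha}\left[(t-a)^{n-1}\mathbb{E}_{m,n}^{l}\big(r(t-a)^{m}\big)\right]\right)(x)=(x-a)^{n-\alpha-1}\,\mathbb{E}_{m,n-\alpha}^{l}\big(r(x-a)^{m}\big)$.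
   Context: Bicomplex numbers: $\mathbb{T}=\{x_0+i_1x_1+i_2x_2+jx_3: x_0,\dots,x_3\in\mathbb{R}\}$ is the commutative ring with $i_1^2=i_2^2=-1$, $i_1i_2=i_2i_1=j$, $j^2=1$. For $\xi=x_0+i_1x_1+i_2x_2+jx_3$ put $\operatorname{Re}(\xi)=x_0$, $\operatorname{Im}_j(\xi)=x_3$. Let $e_1=(1+j)/2$, $e_2=(1-j)/2$ (so $e_1e_2=0$, $e_1+e_2=1$, $e_i^2=e_i$). Writing $\xi=z_1+i_2z_2$ with $z_1,z_2\in\mathbb{C}=\mathbb{R}(i_1)$, one has uniquely $\xi=\xi_1e_1+\xi_2e_2$ with $\xi_1=z_1-i_1z_2$, $\xi_2=z_1+i_1z_2\in\mathbb{C}$; ring operations are componentwise in this idempotent representation. A bicomplex-valued function is written $f=f_1e_1+f_2e_2$ with $f_1,f_2$ complex-valued; integrals and derivatives are componentwise. For $t>0$, $t^{\xi}=t^{\xi_1}e_1+t^{\xi_2}e_2$. The bicomplex Gamma function is $\Gamma_2(\xi)=\Gamma(\xi_1)e_1+\Gamma(\xi_2)e_2$, and $1/\Gamma_2(\xi)$ means $\frac{1}{\Gamma(\xi_1)}e_1+\frac{1}{\Gamma(\xi_2)}e_2$ with $1/\Gamma$ the entire reciprocal Gamma function. The Pochhammer symbol is $(l)_0=1$, $(l)_u=l(l+1)\cdots(l+u-1)$. The bicomplex Prabhakar function is $\mathbb{E}_{m,n}^l(\zeta)=\sum_{u=0}^\infty\frac{(l)_u}{u!\,\Gamma_2(mu+n)}\zeta^u$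 for $\zeta\in\mathbb{T}$. Bicomplex Riemann–Liouville operators, for $\alpha=\alpha_1e_1+\alpha_2e_2$ with $|\operatorname{Im}_j(\alpha)|<\operatorname{Re}(\alpha)$: $(\mathbb{I}_{a+}^{\alpha}f)(x)=\sum_{i=1}^2e_i\,\frac{1}{\Gamma(\alpha_i)}\int_a^x(x-t)^{\alpha_i-1}f_i(t)\,dt$, and $(\mathbb{D}_{a+}^{\alpha}f)(x)=\sum_{i=1}^2e_i\left(\frac{d}{dx}\right)^{q_i}\frac{1}{\Gamma(q_i-\alpha_i)}\int_a^x(x-t)^{q_i-\alpha_i-1}f_i(t)\,dt$ with $q_i=\lfloor\operatorname{Re}(\alpha_i)\rfloor+1$. *)

(* Defs.v *)
From HB Require Import structures.
From mathcomp Require Import all_boot all_order all_algebra.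
From mathcomp Require Import ring.
From mathcomp Require Import all_classical all_reals all_analysis.
From mathcomp Require Import complex.

Set Implicit Arguments.
Unset Strict Implicit.
Unset Printing Implicit Defensive.

Import Order.TTheory GRing.Theory Num.Theory.
Import numFieldNormedType.Exports.

Local Open Scope classical_set_scope.
Local Open Scope ring_scope.
Local Open Scope complex_scope.

(* [Bicomplex x0 x1 x2 x3] is x0 + i_1 x1 + i_2 x2 + j x3. *)
Record bicomplex (R : Type) : Type :=
  Bicomplex { bcx0 : R; bcx1 : R; bcx2 : R; bcx3 : R }.

Section BicomplexRing.
Variable R : realType.

Definition bc_tuple (x : bicomplex R) : R * R * R * R :=
  (bcx0 x, bcx1 x, bcx2 x, bcx3 x).
Definition tuple_bc (t : R * R * R * R) : bicomplex R :=
  let: (x0, x1, x2, x3) := t in Bicomplex x0 x1 x2 x3.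
Lemma bc_tupleK : cancel bc_tuple tuple_bc. Proof. by case. Qed.

HB.instance Definition _ := Choice.copy (bicomplex R) (can_type bc_tupleK).

Definition bc_zero : bicomplex R := Bicomplex 0 0 0 0.
Definition bc_one : bicomplex R := Bicomplex 1 0 0 0.
Definition bc_opp (x : bicomplex R) : bicomplex R :=
  let: Bicomplex x0 x1 x2 x3 := x in Bicomplex (- x0) (- x1) (- x2) (- x3).
Definition bc_add (x y : bicomplex R) : bicomplex R :=
  let: Bicomplex x0 x1 x2 x3 := x in let: Bicomplex y0 y1 y2 y3 := y in
  Bicomplex (x0 + y0) (x1 + y1) (x2 + y2) (x3 + y3).
(* i_1^2 = i_2^2 = -1, i_1 i_2 = i_2 i_1 = j, hence j^2 = 1,
   i_1 j = - i_2 and i_2 j = - i_1. *)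
Definition bc_mul (x y : bicomplex R) : bicomplex R :=
  let: Bicomplex x0 x1 x2 x3 := x in let: Bicomplex y0 y1 y2 y3 := y in
  Bicomplex (x0 * y0 - x1 * y1 - x2 * y2 + x3 * y3)
            (x0 * y1 + x1 * y0 - x2 * y3 - x3 * y2)
            (x0 * y2 + x2 * y0 - x1 * y3 - x3 * y1)
            (x0 * y3 + x3 * y0 + x1 * y2 + x2 * y1).

Lemma bc_addA : associative bc_add.
Proof. by move=> [? ? ? ?] [? ? ? ?] [? ? ? ?]; rewrite /= !addrA. Qed.
Lemma bc_addC : commutative bc_add.
Proof. by move=> [? ? ? ?] [? ? ? ?]; congr Bicomplex; rewrite addrC. Qed.
Lemma bc_add0 : left_id bc_zero bc_add.
Proof. by move=> [? ? ? ?]; rewrite /= !add0r. Qed.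
Lemma bc_addN : left_inverse bc_zero bc_opp bc_add.
Proof. by move=> [? ? ? ?]; rewrite /= !addNr. Qed.

HB.instance Definition _ :=
  GRing.isZmodule.Build (bicomplex R) bc_addA bc_addC bc_add0 bc_addN.

Lemma bc_mulA : associative bc_mul.
Proof. by move=> [? ? ? ?] [? ? ? ?] [? ? ? ?]; congr Bicomplex; ring. Qed.
Lemma bc_mulC : commutative bc_mul.
Proof. by move=> [? ? ? ?] [? ? ? ?]; congr Bicomplex; ring. Qed.
Lemma bc_mul1 : left_id bc_one bc_mul.
Proof. by move=> [? ? ? ?]; congr Bicomplex; ring. Qed.
Lemma bc_mulD : left_distributive bc_mul bc_add.
Proof. by move=> [? ? ? ?] [? ? ? ?] [? ? ? ?]; congr Bicomplex; ring. Qed.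
Lemma bc_one_neq0 : bc_one != 0.
Proof. by apply/eqP => -[] /eqP; rewrite oner_eq0. Qed.

HB.instance Definition _ := GRing.Zmodule_isComNzRing.Build (bicomplex R)
  bc_mulA bc_mulC bc_mul1 bc_mulD bc_one_neq0.

End BicomplexRing.

Section Idempotent.
Variable R : realType.
Implicit Type xi : bicomplex R.

Definition bcRe xi : R := bcx0 xi.
Definition bcImj xi : R := bcx3 xi.

(* The embedding of C = R(i_1). *)
Definition bc_of_complex (z : R[i]) : bicomplex R :=
  Bicomplex (complex.Re z) (complex.Im z) 0 0.

Definition bc_i2 : bicomplex R := Bicomplex 0 0 1 0.
Definition bc_e1 : bicomplex R := Bicomplex 2^-1 0 0 2^-1.
Definition bc_e2 : bicomplex R := Bicomplex 2^-1 0 0 (- 2^-1).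

Definition bcz1 xi : R[i] := bcx0 xi +i* bcx1 xi.
Definition bcz2 xi : R[i] := bcx2 xi +i* bcx3 xi.

Definition idem1 xi : R[i] := bcz1 xi - (0 +i* 1) * bcz2 xi.
Definition idem2 xi : R[i] := bcz1 xi + (0 +i* 1) * bcz2 xi.
Definition of_idem (w1 w2 : R[i]) : bicomplex R :=
  bc_of_complex w1 * bc_e1 + bc_of_complex w2 * bc_e2.

Lemma bc_cartesianE xi :
  xi = bc_of_complex (bcz1 xi) + bc_i2 * bc_of_complex (bcz2 xi).
Proof. by case: xi => ? ? ? ?; congr Bicomplex => /=; ring. Qed.

Lemma of_idemK xi : of_idem (idem1 xi) (idem2 xi) = xi.
Proof. by case: xi => ? ? ? ?; congr Bicomplex => /=; field. Qed.

Lemma idem1K w1 w2 : idem1 (of_idem w1 w2) = w1.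
Proof. by case: w1 w2 => ? ? [? ?]; congr Complex => /=; field. Qed.

Lemma idem2K w1 w2 : idem2 (of_idem w1 w2) = w2.
Proof. by case: w1 w2 => ? ? [? ?]; congr Complex => /=; field. Qed.

Lemma of_idemM w1 w2 v1 v2 :
  of_idem w1 w2 * of_idem v1 v2 = of_idem (w1 * v1) (w2 * v2).
Proof.
by case: w1 w2 v1 v2 => ? ? [? ?] [? ?] [? ?]; congr Bicomplex => /=; field.
Qed.

End Idempotent.

Definition pochhammer (A : pzRingType) (l : A) (u : nat) : A :=
  \prod_(k < u) (l + k%:R).

Section ComplexFunctions.
Variable R : realType.
Implicit Types (z : R[i]) (D : set R) (f : R -> R[i]).
Local Notation mu := (@lebesgue_measure R).

(* t^z = exp (z * ln t), meaningful for t > 0. *)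
Definition cpow (t : R) z : R[i] :=
  (t `^ complex.Re z)%:C *
  (cos (complex.Im z * ln t) +i* sin (complex.Im z * ln t)).

Definition cintegrable D f : Prop :=
  mu.-integrable D (EFin \o (fun t => complex.Re (f t))) /\
  mu.-integrable D (EFin \o (fun t => complex.Im (f t))).

Definition cintegral D f : R[i] :=
  (\int[mu]_(t in D) complex.Re (f t)) +i* (\int[mu]_(t in D) complex.Im (f t)).

Definition cderivable_n (q : nat) f (x : R) : Prop :=
  forall k, (k < q)%N ->
    derivable (derive1n k (fun t => complex.Re (f t))) x 1 /\
    derivable (derive1n k (fun t => complex.Im (f t))) x 1.

Definition cderive_n (q : nat) f (x : R) : R[i] :=
  derive1n q (fun t => complex.Re (f t)) x +i*
  derive1n q (fun t => complex.Im (f t)) x.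

(* Euler's integral for Gamma(z), convergent for Re z > 0. *)
Definition euler_Gamma z : R[i] :=
  cintegral `]0, +oo[ (fun t => cpow t (z - 1) * (expR (- t))%:C).

(* The least k with Re z + k > 0. *)
Definition Gamma_shift z : nat :=
  if 0 < complex.Re z then 0%N else (Num.truncn (- complex.Re z)).+1.

(* The entire function 1/Gamma: 1/Gamma(z) = (z)_k / Gamma(z + k), which is 0
   at the poles 0, -1, -2, ... of Gamma. *)
Definition rGamma z : R[i] :=
  pochhammer z (Gamma_shift z) / euler_Gamma (z + (Gamma_shift z)%:R).

Definition RL_integrand (alpha : R[i]) f (x t : R) : R[i] :=
  cpow (x - t) (alpha - 1) * f t.

Definition cRL_integral (a : R) (alpha : R[i]) f (x : R) : R[i] :=
  rGamma alpha * cintegral `]a, x[ (RL_integrand alpha f x).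

(* [Num.truncn] is the floor on nonnegative reals. *)
Definition RL_order (alpha : R[i]) : nat :=
  (Num.truncn (complex.Re alpha)).+1.

Definition cRL_derivative (a : R) (alpha : R[i]) f (x : R) : R[i] :=
  cderive_n (RL_order alpha)
    (cRL_integral a ((RL_order alpha)%:R - alpha) f) x.

(* The total operators above return junk values when an integral or a derivative
   does not exist; these predicates say that they do exist. *)
Definition cRL_integral_exists (a : R) (alpha : R[i]) f (x : R) : Prop :=
  cintegrable `]a, x[ (RL_integrand alpha f x).

Definition cRL_derivative_exists (a : R) (alpha : R[i]) f (x : R) : Prop :=
  cRL_integral_exists a ((RL_order alpha)%:R - alpha) f x /\
  cderivable_n (RL_order alpha)
    (cRL_integral a ((RL_order alpha)%:R - alpha) f) x.

End ComplexFunctions.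

Section BicomplexFunctions.
Variable R : realType.
Implicit Types (xi zeta alpha m n l : bicomplex R) (f : R -> bicomplex R).

Definition bcpow (t : R) xi : bicomplex R :=
  of_idem (cpow t (idem1 xi)) (cpow t (idem2 xi)).

Definition bcrGamma xi : bicomplex R :=
  of_idem (rGamma (idem1 xi)) (rGamma (idem2 xi)).

(* R[i]^o gives access to the normed topology of the field R[i]. *)
Definition bcseries_cvg (s : nat -> bicomplex R) : Prop :=
  cvgn (series (fun u => idem1 (s u) : R[i]^o)) /\
  cvgn (series (fun u => idem2 (s u) : R[i]^o)).

Definition bcseries_sum (s : nat -> bicomplex R) : bicomplex R :=
  of_idem (limn (series (fun u => idem1 (s u) : R[i]^o)))
          (limn (series (fun u => idem2 (s u) : R[i]^o))).

Definition prabhakar_term m n l zeta (u : nat) : bicomplex R :=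
  pochhammer l u * bc_of_complex (u`!%:R)^-1 *
  bcrGamma (m * u%:R + n) * zeta ^+ u.

Definition prabhakar m n l zeta : bicomplex R :=
  bcseries_sum (prabhakar_term m n l zeta).

Definition bcRL_integral (a : R) alpha f (x : R) : bicomplex R :=
  of_idem (cRL_integral a (idem1 alpha) (fun t => idem1 (f t)) x)
          (cRL_integral a (idem2 alpha) (fun t => idem2 (f t)) x).

Definition bcRL_derivative (a : R) alpha f (x : R) : bicomplex R :=
  of_idem (cRL_derivative a (idem1 alpha) (fun t => idem1 (f t)) x)
          (cRL_derivative a (idem2 alpha) (fun t => idem2 (f t)) x).

Definition bcRL_integral_exists (a : R) alpha f (x : R) : Prop :=
  cRL_integral_exists a (idem1 alpha) (fun t => idem1 (f t)) x /\
  cRL_integral_exists a (idem2 alpha) (fun t => idem2 (f t)) x.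

Definition bcRL_derivative_exists (a : R) alpha f (x : R) : Prop :=
  cRL_derivative_exists a (idem1 alpha) (fun t => idem1 (f t)) x /\
  cRL_derivative_exists a (idem2 alpha) (fun t => idem2 (f t)) x.

End BicomplexFunctions.

(* Main.v *)
From HB Require Import structures.
Require Import Defs.
From mathcomp Require Import all_boot all_order all_algebra.
From mathcomp Require Import ring lra.
From mathcomp Require Import all_classical all_reals all_analysis.
From mathcomp Require Import measurable_realfun complex.

(** A bicomplex number is a pair of complex numbers, its idempotent components,
    and every operation in the theorem acts on each component separately; the
    condition on real and [j]-parts says that both components lie in the right
    half-plane. It remains to treat complex parameters.

    There the theorem is the power rule of fractional calculus applied term by
    term. The Beta integral gives, for [alpha] and [s] in the right half-plane,
      I^alpha [(t - a)^(s-1) / Gamma(s)] (x)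
        = (x - a)^(s+alpha-1) / Gamma(s+alpha)
    ([rGamma_cintegral_pow]). With [s = m u + n] the terms of
    [(t-a)^(n-1) E_(m,n)] go to those of [(x-a)^(n+alpha-1) E_(m,n+alpha)], and
    dominated convergence sums them ([cRL_integral_prabhakar]). For the
    derivative, the fractional integral of order [q - alpha] is thus known on the
    whole half-line, and it is differentiated [q] times. One differentiation
    replaces [y^(s-1) / Gamma(s)] by [y^(s-2) / Gamma(s-1)], because
    [1 / Gamma(z) = z / Gamma(z+1)] for every complex [z], poles of Gamma
    included ([rGammaS]), so that the formula continues to hold when the argument
    leaves the right half-plane. The series may be differentiated termwise, since
    the second derivatives of its terms are locally bounded by a summable
    sequence ([is_derive_series], [derive1n_prabhakar_pow]).

    Three facts about the Gamma function carry these computations.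
    - The relation [Gamma(z) Gamma(w) = B(z,w) Gamma(z+w)] ([euler_Gamma_beta])
      is Fubini's theorem for the kernel [(v-t)^(z-1) t^(w-1) e^(-v)] on the
      sector [0 < t < v].
    - Gamma has no zero in the right half-plane ([euler_Gamma_neq0]): far to the
      right the oscillation of [t^(iy)] is negligible where [t^(x-1) e^(-t)]
      concentrates, and the functional equation brings the result back.
    - The Prabhakar series converges everywhere, even for complex [m], because
      [1 / Gamma(s+m) = B(m,s) / (Gamma(m) Gamma(s))] and [B(m, m u + s)] tends
      to [0] as [u] grows, so that the ratio test applies
      ([prabhakar_coef_summable]). *)

Set Implicit Arguments.
Unset Strict Implicit.
Unset Printing Implicit Defensive.

Import Order.TTheory GRing.Theory Num.Theory.
Import numFieldNormedType.Exports.

Local Open Scope classical_set_scope.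
Local Open Scope ring_scope.
Local Open Scope complex_scope.

Local Notation normc := ComplexField.Normc.normc.
Local Notation Re := complex.Re.
Local Notation Im := complex.Im.

(** * Complex numbers and complex powers *)

Section ComplexBasics.
Variable R : realType.
Implicit Types (z w : R[i]) (t : R).

Lemma complexP z w : Re z = Re w -> Im z = Im w -> z = w.
Proof. by case: z w => a b [c d] /= -> ->. Qed.

Lemma Re_add z w : Re (z + w) = Re z + Re w.
Proof. by case: z w => ? ? []. Qed.
Lemma Im_add z w : Im (z + w) = Im z + Im w.
Proof. by case: z w => ? ? []. Qed.
Lemma Re_sub z w : Re (z - w) = Re z - Re w.
Proof. by case: z w => ? ? []. Qed.
Lemma Im_sub z w : Im (z - w) = Im z - Im w.
Proof. by case: z w => ? ? []. Qed.
Lemma Re_mul z w : Re (z * w) = Re z * Re w - Im z * Im w.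
Proof. by case: z w => ? ? []. Qed.
Lemma Im_mul z w : Im (z * w) = Re z * Im w + Im z * Re w.
Proof. by case: z w => ? ? []. Qed.
Lemma Re_nat (n : nat) : Re (n%:R : R[i]) = n%:R.
Proof. by elim: n => //= n IH; rewrite -[n.+1]addn1 !natrD Re_add IH. Qed.
Lemma Im_nat (n : nat) : Im (n%:R : R[i]) = 0.
Proof. by elim: n => //= n IH; rewrite -[n.+1]addn1 natrD Im_add IH addr0. Qed.
Lemma Re_sum (I : Type) (r : seq I) (P : pred I) (F : I -> R[i]) :
  Re (\sum_(i <- r | P i) F i) = \sum_(i <- r | P i) Re (F i).
Proof. by apply: (big_morph _ Re_add (erefl _)). Qed.
Lemma Im_sum (I : Type) (r : seq I) (P : pred I) (F : I -> R[i]) :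
  Im (\sum_(i <- r | P i) F i) = \sum_(i <- r | P i) Im (F i).
Proof. by apply: (big_morph _ Im_add (erefl _)). Qed.
Lemma rmulc (a : R) z : a%:C * z = (a * Re z) +i* (a * Im z).
Proof. by apply: complexP; rewrite (Re_mul, Im_mul) /=; ring. Qed.

Lemma normc_sqrtE z : normc z = Num.sqrt (Re z ^+ 2 + Im z ^+ 2).
Proof. by case: z. Qed.
Lemma normc_ge0 z : 0 <= normc z.
Proof. by rewrite normc_sqrtE sqrtr_ge0. Qed.
Lemma normc_Re z : `|Re z| <= normc z.
Proof. by rewrite normc_sqrtE -sqrtr_sqr ler_wsqrtr// lerDl sqr_ge0. Qed.
Lemma normc_Im z : `|Im z| <= normc z.
Proof. by rewrite normc_sqrtE -sqrtr_sqr ler_wsqrtr// lerDr sqr_ge0. Qed.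
Lemma normc_le z : normc z <= `|Re z| + `|Im z|.
Proof.
rewrite normc_sqrtE -[leRHS]ger0_norm ?addr_ge0// -sqrtr_sqr ler_wsqrtr//.
rewrite sqrrD !real_normK ?num_real//.
have : 0 <= `|Re z| * `|Im z| by rewrite mulr_ge0.
by lra.
Qed.
Lemma normcX z (n : nat) : normc (z ^+ n) = normc z ^+ n.
Proof.
elim: n => [|n IH]; first by rewrite !expr0 ComplexField.Normc.normc1.
by rewrite !exprS ComplexField.Normc.normcM IH.
Qed.
Lemma normc_real (a : R) : normc (a%:C) = `|a|.
Proof. by rewrite normc_sqrtE /= expr0n addr0 sqrtr_sqr. Qed.
Lemma normr_normc z : `|z| = (normc z)%:C.
Proof. by rewrite normc_def normc_sqrtE. Qed.

(** The norm of [R[i]^o] takes its values in [R[i]], so the radii of its balls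
    are positive elements of [R[i]], that is, positive reals; coordinatewise
    convergence is therefore enough. *)
Lemma cvg_complex (u : nat -> R[i]^o) (l : R[i]^o) :
  (Re (u n) @[n --> \oo] --> Re l) -> (Im (u n) @[n --> \oo] --> Im l) ->
  u @ \oo --> l.
Proof.
move=> hr hi; apply/cvgrPdist_lt => /= e e0.
have [e1 eE] : exists e1 : R, e = e1%:C.
  by exists (Re e); apply: complexP => //=; apply: ger0_Im; exact: ltW.
have e10 : 0 < e1 by rewrite -ltcR -eE.
have e20 : 0 < e1 / 2 by rewrite divr_gt0.
move/cvgrPdist_lt: hr => /(_ _ e20) hr; move/cvgrPdist_lt: hi => /(_ _ e20) hi.
near=> n; rewrite normr_normc eE ltcR.
apply: le_lt_trans (normc_le _) _.
rewrite [e1]splitr ltrD//; [rewrite Re_sub; near: n; exact: hr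
  |rewrite Im_sub; near: n; exact: hi].
Unshelve. all: by end_near. Qed.

Lemma cpowE t z : 0 < t -> cpow t z =
  (expR (Re z * ln t) * cos (Im z * ln t)) +i*
  (expR (Re z * ln t) * sin (Im z * ln t)).
Proof. by move=> t0; rewrite /cpow rmulc/= /powR gt_eqF. Qed.

Lemma Re_cpow t z : Re (cpow t z) = t `^ Re z * cos (Im z * ln t).
Proof. by rewrite /cpow rmulc. Qed.
Lemma Im_cpow t z : Im (cpow t z) = t `^ Re z * sin (Im z * ln t).
Proof. by rewrite /cpow rmulc. Qed.

Lemma cpowD t z w : 0 < t -> cpow t (z + w) = cpow t z * cpow t w.
Proof.
move=> t0; rewrite !cpowE//; apply: complexP; rewrite (Re_mul, Im_mul)/= Re_add Im_add.
  by rewrite !mulrDl expRD cosD; ring.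
by rewrite !mulrDl expRD sinD; ring.
Qed.

Lemma cpowMl t s z : 0 < t -> 0 < s -> cpow (t * s) z = cpow t z * cpow s z.
Proof.
move=> t0 s0; rewrite !cpowE ?mulr_gt0//.
by apply: complexP; rewrite (Re_mul, Im_mul)/= lnM ?posrE// !mulrDr expRD (cosD, sinD);
  ring.
Qed.

Lemma cpow_real t (x : R) : cpow t (x%:C) = (t `^ x)%:C.
Proof. by apply: complexP; rewrite (Re_cpow, Im_cpow)/= mul0r (cos0, sin0); ring. Qed.

Lemma cpow0 t : cpow t 0 = 1.
Proof. by rewrite (cpow_real t 0) powRr0. Qed.

Lemma cpow_nat t (n : nat) : 0 < t -> cpow t n%:R = (t ^+ n)%:C.
Proof.
move=> t0; rewrite -powR_mulrn ?ltW// -cpow_real; congr cpow.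
by apply: complexP; rewrite (Re_nat, Im_nat).
Qed.

Lemma cpow1 t : 0 < t -> cpow t 1 = t%:C.
Proof. by move=> t0; rewrite (cpow_nat 1)// expr1. Qed.

Lemma normc_cpow t z : normc (cpow t z) = t `^ Re z.
Proof.
rewrite /cpow ComplexField.Normc.normcM normc_real ger0_norm ?powR_ge0//.
by rewrite normc_sqrtE/= cos2Dsin2 sqrtr1 mulr1.
Qed.

Lemma cpow_neq0 t z : 0 < t -> cpow t z != 0.
Proof.
move=> t0; apply/eqP => /(congr1 (fun x => normc x))/eqP.
by rewrite normc_cpow ComplexField.Normc.normc0 gt_eqF// powR_gt0.
Qed.

Lemma cpowN t z : 0 < t -> cpow t (- z) = (cpow t z)^-1.
Proof.
move=> t0; apply: (mulfI (cpow_neq0 z t0)).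
by rewrite -cpowD// subrr cpow0 divff// cpow_neq0.
Qed.

Lemma cpowMn t z (n : nat) : 0 < t -> cpow t (z * n%:R) = cpow t z ^+ n.
Proof.
move=> t0; elim: n => [|n IH]; first by rewrite mulr0 cpow0 expr0.
by rewrite -[n.+1]addn1 natrD mulrDr mulr1 cpowD// IH exprD expr1.
Qed.

Lemma measurable_Re_cpow z : measurable_fun [set: R] (fun t => Re (cpow t z)).
Proof.
under eq_fun do rewrite Re_cpow.
apply: measurable_funM; first exact: measurable_powR.
apply: measurableT_comp; first exact: (continuous_measurable_fun (@continuous_cos R)).
by apply: measurable_funM => //; exact: measurable_ln.
Qed.

Lemma measurable_Im_cpow z : measurable_fun [set: R] (fun t => Im (cpow t z)).
Proof.
under eq_fun do rewrite Im_cpow.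
apply: measurable_funM; first exact: measurable_powR.
apply: measurableT_comp; first exact: (continuous_measurable_fun (@continuous_sin R)).
by apply: measurable_funM => //; exact: measurable_ln.
Qed.

End ComplexBasics.

(** * Affine substitution in Lebesgue integrals *)

Section AffineSubstitution.
Variable R : realType.
Local Notation mu := (@lebesgue_measure R).
Variables (k c : R).
Hypothesis k0 : 0 < k.
Let phi := (fun t : R => k * t + c) : R -> measurableTypeR R.

Let mphi : measurable_fun [set: R] phi.
Proof. by apply: measurable_funD => //; exact: measurable_funM. Qed.

Let pushm : {measure set (measurableTypeR R) -> \bar R} :=
  measure_function_pushforward__canonical__measure_function_Measure mu mphi.

(** Both sides are measures in [A], and they agree on intervals. *)
Lemma lebesgue_measure_affine (A : set R) : measurable A ->
  mu A = mscale (NngNum (ltW k0)) pushm A.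
Proof.
move=> mA; apply: lebesgue_measure_unique => // _ [[a b]] _ <-.
change (mu `]a, b]%classic = (k%:E * mu (phi @^-1` `]a, b]%classic))%E).
rewrite (_ : phi @^-1` _ = `](a - c) / k, (b - c) / k]%classic); last first.
  by apply/seteqP; split => t/=; rewrite !in_itv/= /phi
    ltr_pdivrMr// ler_pdivlMr// ltrBlDr lerBrDr [t * k]mulrC.
rewrite !lebesgue_measure_itv/= !lte_fin ltr_pM2r ?invr_gt0// ltrD2r.
case: ifPn => _; last by rewrite mule0.
by rewrite -!EFinD -EFinM; congr EFin; field; rewrite gt_eqF.
Qed.

Lemma ge0_integral_affine (D : set R) (f : R -> \bar R) :
  measurable D -> measurable_fun D f -> (forall t, D t -> (0 <= f t)%E) ->
  (\int[mu]_(t in D) f t = k%:E * \int[mu]_(t in phi @^-1` D) f (phi t))%E.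
Proof.
move=> mD mf f0.
rewrite (eq_measure_integral (mscale (NngNum (ltW k0)) pushm)).
  by rewrite ge0_integral_mscale//= ge0_integral_pushforward// => y /set_mem; exact: f0.
by move=> A mA _; exact: lebesgue_measure_affine.
Qed.

(** The integrands to which this is applied are singular at the ends of their
    domains, so the substitution is proved from the behaviour of the measure
    under affine maps instead of from a primitive. *)
Lemma integral_affine (D : set R) (f : R -> \bar R) :
  measurable D -> mu.-integrable D f ->
  mu.-integrable (phi @^-1` D) (f \o phi) /\
  (\int[mu]_(t in D) f t = k%:E * \int[mu]_(t in phi @^-1` D) f (phi t))%E.
Proof.
move=> mD intf; have mf := measurable_int _ intf.
have mphiD : measurable (phi @^-1` D).
  by rewrite -(setTI (_ @^-1` _)); exact: mphi.
have mfphi : measurable_fun (phi @^-1` D) (f \o phi).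
  apply: (measurable_comp mD) => //; last exact: measurable_funS mphi.
  by move=> _ /= [t Dt <-].
have intfphi : mu.-integrable (phi @^-1` D) (f \o phi).
  apply/integrableP; split => //.
  have /integrableP[_] := intf; rewrite ge0_integral_affine//; last first.
    exact: measurableT_comp.
  move: (\int[_]_(_ in _) _)%E => [r||] h.
  - exact: ltry.
  - by move: h; rewrite gt0_muley ?lte_fin.
  - by rewrite ltNye.
split => //.
have fp : (\int[mu]_(t in D) f^\+ t)%E \is a fin_num.
  by apply: integrable_fin_num => //; exact: integrable_funepos.
have fm : (\int[mu]_(t in D) f^\- t)%E \is a fin_num.
  by apply: integrable_fin_num => //; exact: integrable_funeneg.
have fp' : (\int[mu]_(t in phi @^-1` D) (f \o phi)^\+ t)%E \is a fin_num.
  by apply: integrable_fin_num => //; exact: integrable_funepos.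
have fm' : (\int[mu]_(t in phi @^-1` D) (f \o phi)^\- t)%E \is a fin_num.
  by apply: integrable_fin_num => //; exact: integrable_funeneg.
have ep := ge0_integral_affine mD (measurable_funepos mf) (fun t _ => funepos_ge0 f t).
have en := ge0_integral_affine mD (measurable_funeneg mf) (fun t _ => funeneg_ge0 f t).
rewrite funepos_comp in fp'; rewrite funeneg_comp in fm'.
transitivity (k%:E * \int[mu]_(t in phi @^-1` D) (f \o phi) t)%E => //.
rewrite [X in (_ * X)%E]integralE (funepos_comp f phi) (funeneg_comp f phi).
rewrite muleBr//; first by rewrite [LHS]integralE ep en.
by rewrite fin_num_adde_defl// fin_numN.
Qed.
End AffineSubstitution.

(** * Integrals of complex-valued functions *)

Section ComplexMeasurable.
Variables (R : realType) (d : measure_display) (T : measurableType d).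
Implicit Types (D : set T) (f g : T -> R[i]).

Definition cmeasurable D f :=
  measurable_fun D (fun t => Re (f t)) /\ measurable_fun D (fun t => Im (f t)).

Lemma cmeasurableM D f g : cmeasurable D f -> cmeasurable D g ->
  cmeasurable D (fun t => f t * g t).
Proof.
move=> [fr fi] [gr gi]; split.
  under eq_fun do rewrite Re_mul.
  by apply: measurable_funB; exact: measurable_funM.
under eq_fun do rewrite Im_mul.
by apply: measurable_funD; exact: measurable_funM.
Qed.

Lemma cmeasurable_real D (f : T -> R) : measurable_fun D f ->
  cmeasurable D (fun t => (f t)%:C).
Proof. by split => //=; exact: measurable_cst. Qed.

Lemma cmeasurable_cst D (z : R[i]) : cmeasurable D (fun=> z).
Proof. by split; exact: measurable_cst. Qed.

Lemma cmeasurable_cpow D (h : T -> R) (z : R[i]) : measurable D ->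
  measurable_fun D h -> cmeasurable D (fun t => cpow (h t) z).
Proof.
move=> mD mh; split.
  exact: (measurableT_comp (measurable_Re_cpow z) mh).
exact: (measurableT_comp (measurable_Im_cpow z) mh).
Qed.

Lemma cmeasurable_sum D (F : nat -> T -> R[i]) (n : nat) :
  (forall u, cmeasurable D (F u)) ->
  cmeasurable D (fun t => \sum_(0 <= u < n) F u t).
Proof.
move=> mF; split.
  under eq_fun do rewrite Re_sum.
  by apply: measurable_sum => u; have [] := mF u.
under eq_fun do rewrite Im_sum.
by apply: measurable_sum => u; have [] := mF u.
Qed.

End ComplexMeasurable.

Section ComplexIntegral.
Variable R : realType.
Local Notation mu := (@lebesgue_measure R).
Implicit Types (D : set R) (f g : R -> R[i]).

Lemma cintegrable_le D f (g : R -> R) : measurable D -> cmeasurable D f ->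
  mu.-integrable D (EFin \o g) -> (forall t, D t -> normc (f t) <= g t) ->
  cintegrable D f.
Proof.
move=> mD [fr fi] ig fg; split; apply: le_integrable ig => //.
- exact/measurable_EFinP.
- move=> t Dt /=; rewrite !lee_fin (le_trans (normc_Re _))//.
  by rewrite (le_trans (fg _ Dt))// ler_norm.
- exact/measurable_EFinP.
- move=> t Dt /=; rewrite !lee_fin (le_trans (normc_Im _))//.
  by rewrite (le_trans (fg _ Dt))// ler_norm.
Qed.

Lemma eq_cintegral D f g : {in D, f =1 g} -> cintegral D f = cintegral D g.
Proof.
by move=> fg; rewrite /cintegral; congr (_ +i* _); apply: eq_Rintegral => t tD;
  rewrite fg.
Qed.

Lemma eq_cintegrable D f g : measurable D -> {in D, f =1 g} ->
  cintegrable D f -> cintegrable D g.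
Proof.
move=> mD fg [ir ii]; split.
  by apply: eq_integrable ir => // t tD /=; rewrite fg.
by apply: eq_integrable ii => // t tD /=; rewrite fg.
Qed.

Lemma cintegrableZl D f (z : R[i]) : measurable D -> cintegrable D f ->
  cintegrable D (fun t => z * f t) /\
  cintegral D (fun t => z * f t) = z * cintegral D f.
Proof.
move=> mD [ir ii].
have iz (x : R) (h : R -> R) : mu.-integrable D (EFin \o h) ->
    mu.-integrable D (EFin \o (fun t => x * h t)).
  move=> ih; under [EFin \o _]eq_fun do rewrite /= EFinM.
  by apply: integrableZl.
have eR : (fun t => Re (z * f t)) = (fun t => Re z * Re (f t) - Im z * Im (f t)).
  by apply/funext => t; rewrite Re_mul.
have eI : (fun t => Im (z * f t)) = (fun t => Re z * Im (f t) + Im z * Re (f t)).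
  by apply/funext => t; rewrite Im_mul.
split.
  split.
    rewrite eR; under [EFin \o _]eq_fun do rewrite /= EFinB.
    by apply: integrableB => //; exact: iz.
  rewrite eI; under [EFin \o _]eq_fun do rewrite /= EFinD.
  by apply: integrableD => //; exact: iz.
rewrite /cintegral eR eI RintegralB ?RintegralD ?RintegralZl//; try exact: iz.
by apply: complexP; rewrite (Re_mul, Im_mul).
Qed.

Lemma cintegral_sum D (F : nat -> R -> R[i]) (n : nat) : measurable D ->
  (forall u, cintegrable D (F u)) ->
  cintegrable D (fun t => \sum_(0 <= u < n) F u t) /\
  cintegral D (fun t => \sum_(0 <= u < n) F u t) =
    \sum_(0 <= u < n) cintegral D (F u).
Proof.
move=> mD iF; elim: n => [|n [[IHr IHi] IH]].
  rewrite big_geq//.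
  have E : (fun t : R => \sum_(0 <= u < 0) F u t) = fun=> 0.
    by apply/funext => t; rewrite big_geq.
  rewrite E; split.
    by split => /=; apply: integrable0.
  by rewrite /cintegral/= Rintegral_cst// mul0r.
have E : (fun t : R => \sum_(0 <= u < n.+1) F u t) =
    fun t => \sum_(0 <= u < n) F u t + F n t.
  by apply/funext => t; rewrite big_nat_recr.
rewrite E big_nat_recr//= -IH; have [nr ni] := iF n.
split.
  split.
    under [EFin \o _]eq_fun do rewrite /= Re_add EFinD.
    exact: integrableD.
  under [EFin \o _]eq_fun do rewrite /= Im_add EFinD.
  exact: integrableD.
rewrite /cintegral; under eq_Rintegral do rewrite Re_add.
under [in X in _ +i* X]eq_Rintegral do rewrite Im_add.
by rewrite !RintegralD.
Qed.

Lemma cintegral_affine (k c : R) D f : 0 < k -> measurable D -> cintegrable D f ->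
  cintegrable ((fun t => k * t + c) @^-1` D) (fun t => f (k * t + c)) /\
  cintegral D f =
    k%:C * cintegral ((fun t => k * t + c) @^-1` D) (fun t => f (k * t + c)).
Proof.
move=> k0 mD [ir ii].
have [jr er] := integral_affine c k0 mD ir.
have [ji ei] := integral_affine c k0 mD ii.
have mD' : measurable ((fun t => k * t + c) @^-1` D).
  have mphi : measurable_fun [set: R] (fun t => k * t + c).
    by apply: measurable_funD => //; exact: measurable_funM.
  by rewrite -[X in measurable X]setTI; exact: mphi.
split; first by split.
rewrite /cintegral rmulc/= /Rintegral er ei !fineM//.
- by apply: integrable_fin_num.
- by apply: integrable_fin_num.
Qed.

Lemma cintegral_dominated D (F : nat -> R -> R[i]) f (g : R -> R) :
  measurable D -> (forall n, cmeasurable D (F n)) -> cmeasurable D f ->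
  (forall t, D t -> Re (F n t) @[n --> \oo] --> Re (f t)) ->
  (forall t, D t -> Im (F n t) @[n --> \oo] --> Im (f t)) ->
  mu.-integrable D (EFin \o g) ->
  (forall n t, D t -> normc (F n t) <= g t) ->
  [/\ cintegrable D f,
      Re (cintegral D (F n)) @[n --> \oo] --> Re (cintegral D f) &
      Im (cintegral D (F n)) @[n --> \oo] --> Im (cintegral D f)].
Proof.
move=> mD mF [fr fi] cr ci ig Fg.
have DC (G : nat -> R -> R) (h : R -> R) : (forall n, measurable_fun D (G n)) ->
    measurable_fun D h -> (forall t, D t -> G n t @[n --> \oo] --> h t) ->
    (forall n t, D t -> `|G n t| <= g t) ->
    mu.-integrable D (EFin \o h) /\
    \int[mu]_(t in D) G n t @[n --> \oo] --> \int[mu]_(t in D) h t.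
  move=> mG mh Gh Gg.
  have [|||||ih _ ch] := @dominated_convergence _ _ _ mu D mD
    (fun n => EFin \o G n) (EFin \o h) (EFin \o g).
  - by move=> n; apply/measurable_EFinP; apply: mG.
  - by apply/measurable_EFinP; apply: mh.
  - by apply: aeW => t Dt; apply: cvg_EFin; [exact: nearW|exact: Gh].
  - exact: ig.
  - by apply: aeW => t n Dt /=; rewrite lee_fin; exact: Gg.
  - split => //; apply: fine_cvg; rewrite fineK//; exact: integrable_fin_num.
have [ir er] := DC _ _ (fun n => (mF n).1) fr cr
  (fun n t Dt => le_trans (normc_Re _) (Fg n t Dt)).
have [ii ei] := DC _ _ (fun n => (mF n).2) fi ci
  (fun n t Dt => le_trans (normc_Im _) (Fg n t Dt)).
by split.
Qed.

End ComplexIntegral.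

(** * The fundamental theorem of calculus on the half-line *)

Section ImproperFTC.
Variable R : realType.
Local Notation mu := (@lebesgue_measure R).
Local Notation Rp := (`]0%R, +oo[%classic : set R).
Implicit Types (f F : R -> R).

(** Starting at [2] keeps the two endpoints distinct for every [n]. *)
Definition exhaust (n : nat) : set R := `[n.+2%:R^-1, n.+2%:R]%classic.

Lemma exhaust_lt (n : nat) : n.+2%:R^-1 < n.+2%:R :> R.
Proof.
apply: (@lt_trans _ _ 1); last by rewrite ltr1n.
by rewrite invf_lt1 ?ltr0n// ltr1n.
Qed.

Lemma exhaust_gt0 (n : nat) t : exhaust n t -> 0 < t.
Proof.
rewrite /exhaust/= in_itv/= => /andP[+ _]; apply: lt_le_trans.
by rewrite invr_gt0 ltr0n.
Qed.

Lemma measurable_exhaust (n : nat) : measurable (exhaust n).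
Proof. exact: measurable_itv. Qed.

Lemma exhaust_homo : {homo exhaust : n m / (n <= m)%N >-> (n <= m)%O}.
Proof.
move=> n m nm; apply/subsetPset => t; rewrite /exhaust/= !in_itv/= => /andP[h1 h2].
rewrite (le_trans h2) ?ler_nat// andbT (le_trans _ h1)//.
by rewrite lef_pV2 ?posrE ?ltr0n// ler_nat.
Qed.

Lemma near_exhaust t : 0 < t -> \forall n \near \oo, exhaust n t.
Proof.
move=> t0.
pose N := maxn (Num.truncn t).+1 (Num.truncn t^-1).+1.
exists N => // n /= Nn; rewrite /exhaust/= in_itv/=; apply/andP; split.
  rewrite -[leRHS]invrK lef_pV2 ?posrE ?ltr0n ?invr_gt0//.
  apply: le_trans (ltW (truncnS_gt _)) _; rewrite ler_nat.
  by apply: leq_trans (leq_trans Nn _); [exact: leq_maxr|rewrite -addn2 leq_addr].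
apply: le_trans (ltW (truncnS_gt _)) _; rewrite ler_nat.
by apply: leq_trans (leq_trans Nn _); [exact: leq_maxl|rewrite -addn2 leq_addr].
Qed.

Lemma in0y (t : R) : `]0%R, +oo[%classic t <-> 0 < t.
Proof. by rewrite set_itvE. Qed.

Lemma bigcup_exhaust : \bigcup_n exhaust n = `]0, +oo[%classic.
Proof.
apply/seteqP; split => [t [n _]|t].
  by move/exhaust_gt0 => t0; apply/in0y.
move=> /in0y /near_exhaust [n _ h].
by exists n => //; apply: h => /=.
Qed.

Lemma FTC_exhaust f F (n : nat) :
  (forall t : R, 0 < t -> {for t, continuous f}) ->
  (forall t : R, 0 < t -> is_derive t 1 F (f t)) ->
  (\int[mu]_(t in exhaust n) (f t)%:E = (F n.+2%:R)%:E - (F n.+2%:R^-1)%:E)%E.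
Proof.
move=> cf dF.
have cF (t : R) : 0 < t -> {for t, continuous F}.
  move=> t0; apply: differentiable_continuous; apply/derivable1_diffP.
  by have [] := dF _ t0.
have p1 : 0 < n.+2%:R^-1 :> R by rewrite invr_gt0 ltr0n.
have p2 : 0 < n.+2%:R :> R by rewrite ltr0n.
apply: continuous_FTC2; first exact: exhaust_lt.
- apply: continuous_in_subspaceT => t; rewrite inE => /exhaust_gt0; exact: cf.
- split.
  + move=> t; rewrite in_itv/= => /andP[h _].
    by have [] := dF _ (lt_trans p1 h).
  + by apply: cvg_at_right_filter; exact: cF.
  + by apply: cvg_at_left_filter; exact: cF.
- move=> t; rewrite in_itv/= => /andP[h _].
  by rewrite derive1E; have [_ ->] := dF _ (lt_trans p1 h).
Qed.

Lemma measurable_0y f : (forall t : R, 0 < t -> {for t, continuous f}) ->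
  measurable_fun Rp f.
Proof.
move=> cf; apply: open_continuous_measurable_fun; first exact: interval_open.
by move=> t; rewrite inE => /in0y; exact: cf.
Qed.

(** Monotone convergence along compact intervals, over which the integrals are
    differences of values of the bounded function [F]. *)
Lemma integrable_0y f F (M : R) :
  (forall t : R, 0 < t -> {for t, continuous f}) ->
  (forall t : R, 0 < t -> is_derive t 1 F (f t)) ->
  (forall t : R, 0 < t -> 0 <= f t) -> (forall t : R, 0 < t -> `|F t| <= M) ->
  mu.-integrable Rp (EFin \o f).
Proof.
move=> cf dF f0 FM; apply/integrableP; split.
  by apply/measurable_EFinP; exact: measurable_0y.
rewrite (_ : (\int[mu]_(t in Rp) `|(EFin \o f) t|)%E =
    (\int[mu]_(t in Rp) (f t)%:E)%E); last first.
  apply: eq_integral => t; rewrite inE => /in0y t0.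
  by rewrite gee0_abs// lee_fin f0.
rewrite -bigcup_exhaust.
have mf n : measurable_fun (exhaust n) (EFin \o f).
  apply/measurable_EFinP; apply: measurable_funS (measurable_0y cf) => //.
  by move=> t /exhaust_gt0 t0; apply/in0y.
have := ge0_nondecreasing_set_cvg_integral (mu := mu) exhaust_homo
  measurable_exhaust mf _.
have p0 n t : exhaust n t -> (0 <= (EFin \o f) t)%E.
  by move/exhaust_gt0 => t0; rewrite lee_fin f0.
move=> /(_ p0) cvgI.
rewrite -(cvg_lim _ cvgI)//; apply: (@le_lt_trans _ _ (M + M)%:E); last exact: ltry.
apply: lime_le; first by apply/cvg_ex; eexists; exact: cvgI.
apply: nearW => n; rewrite FTC_exhaust// -EFinB lee_fin.
apply: le_trans (ler_norm _) _; apply: le_trans (ler_normB _ _) _.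
by rewrite lerD// FM// ?invr_gt0 ltr0n.
Qed.

(** The integrand may change sign, so the passage to the limit along the compact
    intervals uses dominated convergence. *)
Lemma Rintegral_0y f F (l l0 : R) :
  (forall t : R, 0 < t -> {for t, continuous f}) ->
  (forall t : R, 0 < t -> is_derive t 1 F (f t)) ->
  mu.-integrable Rp (EFin \o f) ->
  F n.+2%:R @[n --> \oo] --> l -> F n.+2%:R^-1 @[n --> \oo] --> l0 ->
  \int[mu]_(t in Rp) f t = l - l0.
Proof.
move=> cf dF intf Fl Fl0.
have mf := measurable_0y cf.
have mfn n : measurable_fun Rp (f \_ (exhaust n)).
  have mRp : measurable Rp by exact: measurable_itv.
  have mfn : measurable_fun (Rp `&` exhaust n) f.
    by apply: (measurable_funS mRp _ mf) => t [].
  exact: ((measurable_restrict f (measurable_exhaust n) mRp).1 mfn).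
have [||||||_ _ h] := @dominated_convergence _ _ _ mu Rp _
    (fun n => EFin \o (f \_ (exhaust n))) (EFin \o f) (fun t => `|(f t)%:E|%E).
- by [].
- by move=> n; apply/measurable_EFinP; apply: mfn.
- exact/measurable_EFinP.
- apply: aeW => t /in0y /near_exhaust nt.
  apply: cvg_near_cst; apply: filterS nt => n nt.
  by rewrite /= patchE mem_set.
- exact: integrable_abse.
- apply: aeW => t n _ /=; rewrite patchE; case: ifPn => _ //.
  by rewrite normr0 lee_fin.
rewrite /Rintegral.
have : (\int[mu]_(x in Rp) (EFin \o f \_ (exhaust n)) x)%E
    @[n --> \oo] --> (l - l0)%:E.
  have -> : (fun n => \int[mu]_(x in Rp) (EFin \o f \_ (exhaust n)) x)%E =
      (fun n => (F n.+2%:R - F n.+2%:R^-1)%:E).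
    apply/funext => n; rewrite EFinB -(FTC_exhaust n cf dF).
    rewrite -restrict_EFin -integral_mkcondr.
    by rewrite setIidr// => t /exhaust_gt0 t0; apply/in0y.
  by apply: cvg_EFin; [exact: nearW|exact: cvgB].
by move/(cvg_unique _ h) => -> //.
Qed.

End ImproperFTC.

(** * Euler's Gamma integral *)

Section GammaIntegral.
Variable R : realType.
Local Notation mu := (@lebesgue_measure R).
Local Notation Rp := (`]0%R, +oo[%classic : set R).
Implicit Types (t x : R) (z : R[i]).

Lemma powR_le_exprn t x (n : nat) : 0 < t -> 0 <= x -> x <= n%:R ->
  t `^ x <= 1 + t ^+ n.
Proof.
move=> t0 x0 xn; have [t1|t1] := leP t 1.
  rewrite ler_wpDr ?exprn_ge0 ?(ltW t0)//.
  by rewrite -(powRr0 t); apply: ger_powR => //; rewrite t0.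
rewrite -powR_mulrn ?(ltW t0)// ler_wpDl// ler_powR//; exact: ltW.
Qed.

Lemma exprn_expRN t (n : nat) : 0 <= t -> t ^+ n * expR (- t) <= n`!%:R.
Proof.
move=> t0; rewrite expRN ler_pdivrMr ?expR_gt0//.
case: n => [|n]; first by rewrite expr0 mul1r -expR0 ler_expR.
rewrite mulrC -ler_pdivrMr ?ltr0n ?fact_gt0//.
by apply: le_trans (expR_ge1Dxn n t0); rewrite lerDr.
Qed.

Definition rgamma x t := t `^ (x - 1) * expR (- t).

Lemma rgamma_ge0 x t : 0 <= rgamma x t.
Proof. by rewrite mulr_ge0 ?powR_ge0 ?expR_ge0. Qed.

Lemma measurable_expRN D : measurable_fun D (fun t : R => expR (- t)).
Proof.
apply: measurable_funTS; apply: measurableT_comp; first exact: measurable_expR.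
by apply: continuous_measurable_fun; exact: opp_continuous.
Qed.

Lemma measurable_rgamma D x : measurable_fun D (rgamma x).
Proof.
apply: measurable_funM; last exact: measurable_expRN.
by apply: measurable_funTS; exact: measurable_powR.
Qed.

(** The integrand is at most a constant times the derivative of the bounded
    function [- 1 / (1 + t ^ x)]. *)
Lemma integrable_rgamma x : 0 < x -> mu.-integrable Rp (EFin \o rgamma x).
Proof.
move=> x0; pose h t := x * t `^ (x - 1) / (1 + t `^ x) ^+ 2.
have d1 t : 0 < 1 + t `^ x by rewrite ltr_pwDl ?powR_ge0.
have cpowR (y t : R) : 0 < t -> {for t, continuous (fun s : R => s `^ y)}.
  move=> t0; apply: differentiable_continuous; apply/derivable1_diffP.
  by have [] := is_derive1_powR y t0.
have ch t : 0 < t -> {for t, continuous h}.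
  move=> t0; apply: cvgM; first by apply: cvgM; [exact: cvg_cst|exact: cpowR].
  apply: cvgV; first by rewrite expf_neq0// gt_eqF.
  apply: (@continuous_comp _ _ _ (fun s : R => 1 + s `^ x) (fun u => u ^+ 2)).
    by apply: cvgD; [exact: cvg_cst|exact: cpowR].
  exact: exprn_continuous.
have dh t : 0 < t -> is_derive t 1 (fun s : R => - (1 + s `^ x)^-1) (h t).
  move=> t0; have dp := is_derive1_powR x t0.
  have dq : is_derive t 1 (fun s : R => 1 + s `^ x) (x * t `^ (x - 1)).
    have dc := is_derive_cst (1 : R) t (1 : R).
    by apply: (is_derive_eq (is_deriveD dc dp)); rewrite add0r.
  have := is_deriveN (is_deriveV (f := fun s : R => 1 + s `^ x) (lt0r_neq0 (d1 t)) dq).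
  move=> dV; apply: (is_derive_eq dV); rewrite /h.
  rewrite -scaleNr opprK /GRing.scale/=.
  by field; rewrite lt0r_neq0.
have ih : mu.-integrable Rp (EFin \o h).
  apply: (@integrable_0y R h _ 1) dh _ _ => //.
    by move=> t _; rewrite divr_ge0 ?mulr_ge0 ?(ltW x0) ?powR_ge0 ?exprn_ge0 ?(ltW (d1 t)).
  move=> t t0; rewrite normrN gtr0_norm ?invr_gt0// invf_le1//.
  by rewrite lerDl powR_ge0.
(* With [x <= N], [(1 + t ^ x) ^ 2 <= (2 + t ^ N) ^ 2 <= 8 + 2 t ^ (2 N)],
   and [e ^ (- t)] absorbs this polynomial at the cost of a factorial. *)
pose N := (Num.truncn x).+1.
pose C : R := (8 + 2 * (N + N)`!%:R) / x.
have iCh : mu.-integrable Rp (EFin \o (fun t => C * h t)).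
  by under [EFin \o _]eq_fun do rewrite /= EFinM; apply: integrableZl.
apply: le_integrable iCh => //.
  by apply/measurable_EFinP; apply: measurable_rgamma.
move=> t /in0y t0 /=; rewrite lee_fin ger0_norm ?rgamma_ge0//.
apply: le_trans (ler_norm _); rewrite /C /h /rgamma.
have -> : (8 + 2 * (N + N)`!%:R) / x * (x * t `^ (x - 1) / (1 + t `^ x) ^+ 2) =
    t `^ (x - 1) * ((8 + 2 * (N + N)`!%:R) / (1 + t `^ x) ^+ 2).
  by field; rewrite !lt0r_neq0.
rewrite ler_wpM2l ?powR_ge0// ler_pdivlMr ?exprn_gt0//.
have xN : x <= N%:R by exact/ltW/truncnS_gt.
have h1 : 1 + t `^ x <= 2 + t ^+ N.
  by have := powR_le_exprn t0 (ltW x0) xN; lra.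
have h2 : (1 + t `^ x) ^+ 2 <= 8 + 2 * t ^+ (N + N).
  apply: (@le_trans _ _ ((2 + t ^+ N) ^+ 2)).
    by rewrite lerXn2r// nnegrE ?(ltW (d1 t))// addr_ge0// exprn_ge0// ltW.
  rewrite exprD; have : 0 <= (t ^+ N - 2) ^+ 2 by exact: sqr_ge0.
  by rewrite !expr2; nra.
apply: (@le_trans _ _ (expR (- t) * (8 + 2 * t ^+ (N + N)))).
  by rewrite ler_wpM2l ?expR_ge0.
rewrite mulrDr; apply: lerD.
  by rewrite ger_pMl// expR_le1 lerNl oppr0 ltW.
by rewrite mulrCA ler_pM2l// mulrC exprn_expRN// ltW.
Qed.

Definition gamma_fun z t : R[i] := cpow t (z - 1) * (expR (- t))%:C.

Lemma normc_gamma_fun z t : normc (gamma_fun z t) = rgamma (Re z) t.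
Proof.
rewrite /gamma_fun ComplexField.Normc.normcM normc_cpow normc_real.
by rewrite ger0_norm ?expR_ge0// Re_sub.
Qed.

Lemma cmeasurable_gamma_fun (D : set R) z : measurable D ->
  cmeasurable D (gamma_fun z).
Proof.
move=> mD; apply: cmeasurableM; first exact: cmeasurable_cpow.
by apply: cmeasurable_real; exact: measurable_expRN.
Qed.

Lemma cintegrable_gamma_fun z : 0 < Re z -> cintegrable Rp (gamma_fun z).
Proof.
move=> z0; apply: (cintegrable_le _ _ (integrable_rgamma z0)) => //.
  exact: cmeasurable_gamma_fun.
by move=> t _; rewrite normc_gamma_fun.
Qed.

(** The factor [c] covers the imaginary part as well, which is the real part of
    the product with [- i]. *)
Lemma is_derive_cpow (c z : R[i]) t : 0 < t ->
  is_derive t 1 (fun s => Re (c * cpow s z)) (Re (c * z * cpow t (z - 1))).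
Proof.
move=> t0.
have dln : is_derive t 1 (@ln R) t^-1 := is_derive1_ln t0.
have dk (k : R) : is_derive t 1 (fun s : R => k * ln s) (k * t^-1).
  exact: (is_deriveZ k dln).
have dE : is_derive t 1 (fun s : R => expR (Re z * ln s))
    (expR (Re z * ln t) * (Re z * t^-1)).
  exact: (is_derive1_comp (is_derive_expR _) (dk _)).
have dC : is_derive t 1 (fun s : R => cos (Im z * ln s))
    (- sin (Im z * ln t) * (Im z * t^-1)).
  exact: (is_derive1_comp (is_derive_cos _) (dk _)).
have dS : is_derive t 1 (fun s : R => sin (Im z * ln s))
    (cos (Im z * ln t) * (Im z * t^-1)).
  exact: (is_derive1_comp (is_derive_sin _) (dk _)).
have dd := is_deriveB (is_deriveZ (Re c) (is_deriveM dE dC))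
  (is_deriveZ (Im c) (is_deriveM dE dS)).
apply: (near_eq_is_derive _ (is_derive_eq dd _)).
  near=> s; have s0 : 0 < s by near: s; exact: lt_nbhsr.
  by rewrite Re_mul cpowE.
rewrite /GRing.scale/= cpowD// cpowN// cpow1//.
have -> : (t%:C)^-1 = (t^-1)%:C :> R[i] by rewrite fmorphV.
rewrite cpowE//; case: c z {dk dE dC dS dd} => c1 c2 [z1 z2]/=.
by ring.
Unshelve. all: by end_near. Qed.

Lemma continuous_Re_cpow (c z : R[i]) t : 0 < t ->
  {for t, continuous (fun s => Re (c * cpow s z))}.
Proof.
move=> t0; apply: differentiable_continuous; apply/derivable1_diffP.
by have [] := is_derive_cpow c z t0.
Qed.

Lemma is_derive_expRN t : is_derive t 1 (fun s : R => expR (- s)) (- expR (- t)).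
Proof.
have dN : is_derive t 1 (fun s : R => - s) (- 1).
  exact: (is_deriveN (is_derive_id t 1)).
by apply: (is_derive_eq (is_derive1_comp (is_derive_expR _) dN)); rewrite mulrN1.
Qed.

Lemma cvg_invSS : (n.+2%:R^-1 : R) @[n --> \oo] --> 0.
Proof.
have := @cvg_harmonic R; rewrite -(cvg_shiftS (@harmonic R)).
exact.
Qed.

Lemma cvg_rgamma_0 x : 0 < x -> rgamma (x + 1) n.+2%:R^-1 @[n --> \oo] --> 0.
Proof.
move=> x0; apply: (@squeeze_cvgr _ _ _ _ (fun=> 0) (fun n => n.+2%:R^-1 `^ x)).
- apply: nearW => n; rewrite rgamma_ge0/= /rgamma addrK ler_piMr ?powR_ge0//.
- exact: cvg_cst.
- have /cvg_at_rightP := powR_cvg0 x0; apply; split; last exact: cvg_invSS.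
  by move=> n; rewrite invr_gt0 ltr0n.
Qed.

Lemma cvg_rgamma_y x : 0 < x -> rgamma (x + 1) n.+2%:R @[n --> \oo] --> 0.
Proof.
move=> x0; pose N := (Num.truncn x).+1.
have xN : x <= N%:R by exact/ltW/truncnS_gt.
pose C : R := 1 + N.+1`!%:R.
apply: (@squeeze_cvgr _ _ _ _ (fun=> 0) (fun n => C * n.+2%:R^-1)).
- apply: nearW => n; rewrite rgamma_ge0/= /rgamma addrK.
  have t0 : 0 < n.+2%:R :> R by rewrite ltr0n.
  apply: (@le_trans _ _ ((1 + n.+2%:R ^+ N) * expR (- n.+2%:R))).
    by rewrite ler_wpM2r ?expR_ge0// powR_le_exprn// ltW.
  rewrite ler_pdivlMr// mulrDl mulrDl mul1r /C; apply: lerD.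
    by have := exprn_expRN 1 (ltW t0); rewrite expr1 mulrC.
  by have := exprn_expRN N.+1 (ltW t0); rewrite exprSr mulrAC.
- exact: cvg_cst.
- by rewrite -[X in _ --> X](mulr0 C); apply: cvgM; [exact: cvg_cst|exact: cvg_invSS].
Qed.

Lemma Re_cpow_expRN (c z : R[i]) t :
  `|Re (c * cpow t z) * expR (- t)| <= normc c * rgamma (Re z + 1) t.
Proof.
rewrite normrM (ger0_norm (expR_ge0 _)).
rewrite /rgamma addrK [leRHS]mulrA ler_wpM2r ?expR_ge0//.
by rewrite (le_trans (normc_Re _))// ComplexField.Normc.normcM normc_cpow.
Qed.

Lemma euler_GammaE z : euler_Gamma z = cintegral Rp (gamma_fun z).
Proof. by []. Qed.

Lemma Re_cintegral (D : set R) (c : R[i]) (f : R -> R[i]) :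
  measurable D -> cintegrable D f ->
  mu.-integrable D (EFin \o (fun t => Re (c * f t))) /\
  Re (c * cintegral D f) = \int[mu]_(t in D) Re (c * f t).
Proof. by move=> mD intf; have [[ir _] <-] := cintegrableZl c mD intf. Qed.

(** Testing a complex equation on the real parts of all multiples of its two
    sides leaves a single real function to integrate or differentiate. *)
Lemma Re_inj (z w : R[i]) : (forall c, Re (c * z) = Re (c * w)) -> z = w.
Proof.
move=> h; apply: complexP; first by have := h 1; rewrite !mul1r.
by have := h (0 -i* 1); rewrite !Re_mul/= !mul0r !sub0r !mulN1r !opprK.
Qed.

(** Integration by parts: [z t^(z-1) e^(-t) - t^z e^(-t)] is the derivative of
    [t^z e^(-t)], which vanishes at both ends of the half-line. *)
Lemma euler_GammaS z : 0 < Re z -> euler_Gamma (z + 1) = z * euler_Gamma z.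
Proof.
move=> z0; apply: Re_inj => c; rewrite mulrA !euler_GammaE.
have z1 : 0 < Re (z + 1) by rewrite Re_add/= addr_gt0.
have mRp : measurable Rp by exact: measurable_itv.
have [i1 ->] := Re_cintegral c mRp (cintegrable_gamma_fun z1).
have [i2 ->] := Re_cintegral (c * z) mRp (cintegrable_gamma_fun z0).
apply/eqP; rewrite eq_sym -subr_eq0 -RintegralB//.
apply/eqP; rewrite -[RHS](subr0 0).
have gE w (e : R[i]) t : Re (e * gamma_fun w t) =
    Re (e * cpow t (w - 1)) * expR (- t).
  by rewrite /gamma_fun mulrA Re_mul/= mulr0 subr0.
under eq_Rintegral do rewrite !gE addrK.
pose F t := Re (c * cpow t z) * expR (- t).
apply: (@Rintegral_0y R _ F).
- move=> t t0; apply: cvgB; apply: cvgM.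
  + exact: continuous_Re_cpow.
  + by apply: (@continuous_comp _ _ _ -%R expR); [exact: opp_continuous|exact: continuous_expR].
  + exact: continuous_Re_cpow.
  + by apply: (@continuous_comp _ _ _ -%R expR); [exact: opp_continuous|exact: continuous_expR].
- move=> t t0; apply: (is_derive_eq (is_deriveM (is_derive_cpow c z t0) (is_derive_expRN t))).
  by rewrite /GRing.scale/=; ring.
- suff : mu.-integrable Rp (EFin \o (fun t =>
      Re (c * z * gamma_fun z t) - Re (c * gamma_fun (z + 1) t))).
    by apply: eq_integrable => // t _ /=; rewrite !gE addrK.
  by under [EFin \o _]eq_fun do rewrite /= EFinB; apply: integrableB.
- apply: norm_cvg0; apply: (@squeeze_cvgr _ _ _ _ (fun=> 0)
    (fun n => normc c * rgamma (Re z + 1) n.+2%:R)).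
  + by apply: nearW => n; rewrite normr_ge0/= Re_cpow_expRN.
  + exact: cvg_cst.
  + by rewrite -[X in _ --> X](mulr0 (normc c)); apply: cvgM;
      [exact: cvg_cst|exact: cvg_rgamma_y].
- apply: norm_cvg0; apply: (@squeeze_cvgr _ _ _ _ (fun=> 0)
    (fun n => normc c * rgamma (Re z + 1) n.+2%:R^-1)).
  + by apply: nearW => n; rewrite normr_ge0/= Re_cpow_expRN.
  + exact: cvg_cst.
  + by rewrite -[X in _ --> X](mulr0 (normc c)); apply: cvgM;
      [exact: cvg_cst|exact: cvg_rgamma_0].
Qed.

End GammaIntegral.

(** * The Beta integral *)

Section BetaIntegral.
Variable R : realType.
Local Notation mu := (@lebesgue_measure R).
Local Notation Rp := (`]0%R, +oo[%classic : set R).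
Implicit Types (t v x : R) (z w : R[i]).

Lemma cintegral_mkcond (D : set R) (f : R -> R[i]) :
  cintegral D f = cintegral setT (fun t => if t \in D then f t else 0).
Proof.
rewrite /cintegral !(Rintegral_mkcond mu D); congr (_ +i* _);
by apply: eq_Rintegral => t _; rewrite patchE; case: ifP.
Qed.

Lemma cintegrable_mkcond (D : set R) (f : R -> R[i]) : measurable D ->
  cintegrable D f <-> cintegrable setT (fun t => if t \in D then f t else 0).
Proof.
move=> mD.
have E (g : R[i] -> R) : g 0 = 0 ->
    (EFin \o (fun t => g (f t))) \_ D =
    EFin \o (fun t => g (if t \in D then f t else 0)).
  by move=> g0; apply/funext => t; rewrite patchE /=; case: ifP => // _; rewrite g0.
have Ei (g : R -> \bar R) : mu.-integrable D g <-> mu.-integrable setT (g \_ D).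
  by rewrite -integrable_mkcond.
split => -[h1 h2]; split.
- by rewrite -E//; apply/Ei.
- by rewrite -E//; apply/Ei.
- by apply/Ei; rewrite E.
- by apply/Ei; rewrite E.
Qed.

Definition beta_integrand z w v : R[i] := cpow (1 - v) (z - 1) * cpow v (w - 1).

Lemma cmeasurable_beta_integrand (D : set R) z w : measurable D ->
  cmeasurable D (beta_integrand z w).
Proof.
move=> mD; apply: cmeasurableM; last exact: cmeasurable_cpow.
by apply: cmeasurable_cpow => //; exact: measurable_funB.
Qed.

Definition complex_beta z w : R[i] := cintegral `]0, 1[ (beta_integrand z w).

(** At fixed [t] its slices are translates of a Gamma integrand, at fixed [v]
    dilations of a Beta integrand. *)
Definition beta_kernel z w (p : R * R) : R[i] :=
  if (0 < p.1) && (p.1 < p.2)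
  then cpow (p.2 - p.1) (z - 1) * cpow p.1 (w - 1) * (expR (- p.2))%:C else 0.

Lemma cmeasurable_beta_kernel z w :
  cmeasurable [set: R * R] (beta_kernel z w).
Proof.
pose b (p : R * R) := (0 < p.1) && (p.1 < p.2).
pose f (p : R * R) := cpow (p.2 - p.1) (z - 1) * cpow p.1 (w - 1) * (expR (- p.2))%:C.
have mb : measurable_fun setT b.
  apply: measurable_and; apply: measurable_fun_ltr => //.
have [mfr mfi] : cmeasurable setT f.
  apply: cmeasurableM; first apply: cmeasurableM.
  - by apply: cmeasurable_cpow => //; apply: measurable_funB.
  - exact: cmeasurable_cpow.
  - apply: cmeasurable_real.
    apply: (measurableT_comp (@measurable_expRN R setT) (@measurable_snd _ _ _ _)).
split.
  rewrite (_ : (fun p => _) = (fun p => if b p then Re (f p) else 0)).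
    exact: measurable_fun_ifT.
  by apply/funext => p; rewrite /beta_kernel -/(b p); case: ifP.
rewrite (_ : (fun p => _) = (fun p => if b p then Im (f p) else 0)).
  exact: measurable_fun_ifT.
by apply/funext => p; rewrite /beta_kernel -/(b p); case: ifP.
Qed.

Lemma beta_kernel_slice1 z w t : 0 < Re z ->
  cintegrable setT (fun v => beta_kernel z w (t, v)) /\
  cintegral setT (fun v => beta_kernel z w (t, v)) =
    if t \in Rp then euler_Gamma z * gamma_fun w t else 0.
Proof.
move=> z0; case: ifPn => [|/negP]; rewrite inE.
  move=> /in0y t0.
  have mRp : measurable Rp by exact: measurable_itv.
  have [ia ea] := cintegral_affine (- t) ltr01 mRp (cintegrable_gamma_fun z0).
  have mDt : measurable ((fun v => 1 * v - t) @^-1` Rp).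
    have mphi : measurable_fun [set: R] (fun v => 1 * v - t).
      by apply: measurable_funB => //; exact: measurable_funM.
    by rewrite -[X in measurable X]setTI; exact: mphi.
  have [iZ eZ] := cintegrableZl (gamma_fun w t) mDt ia.
  have E v : beta_kernel z w (t, v) =
      if v \in (fun v => 1 * v - t) @^-1` Rp
      then gamma_fun w t * gamma_fun z (1 * v - t) else 0.
    rewrite /beta_kernel/= t0/=; have [tv|tv] := ltP t v.
      rewrite mem_set; last by apply/in0y; rewrite mul1r subr_gt0.
      rewrite /gamma_fun mul1r (_ : - v = - t + - (v - t)); last by ring.
      by rewrite expRD rmorphM/=; ring.
    rewrite memNset// => /in0y; rewrite mul1r subr_gt0.
    by move=> /(le_lt_trans tv); rewrite ltxx.
  split.
    by under [fun v => _]eq_fun do rewrite E; apply/(cintegrable_mkcond _ mDt).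
  under [fun v => _]eq_fun do rewrite E.
  rewrite -cintegral_mkcond eZ euler_GammaE ea.
  by rewrite mulrC (_ : 1%:C = 1)// mul1r.
move=> /in0y/negP; rewrite -leNgt => t0.
have E v : beta_kernel z w (t, v) = 0 by rewrite /beta_kernel/= ltNge t0.
under [fun v => _]eq_fun do rewrite E.
split; first by split => /=; exact: integrable0.
by rewrite /cintegral/= Rintegral_cst// mul0r.
Qed.

Lemma normc_beta_kernel z w p :
  normc (beta_kernel z w p) = Re (beta_kernel (Re z)%:C (Re w)%:C p).
Proof.
rewrite /beta_kernel; case: ifP => _; last by rewrite ComplexField.Normc.normc0.
rewrite ComplexField.Normc.normcM [X in X * _]ComplexField.Normc.normcM !normc_cpow normc_real ger0_norm ?expR_ge0//.
have E (y : R) : y%:C - 1 = (y - 1)%:C :> R[i] by rewrite rmorphB.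
by rewrite !E !cpow_real !(Re_mul, Im_mul)/= !Re_sub/=; ring.
Qed.

Lemma Re_beta_kernel_ge0 (a b : R) p : 0 <= Re (beta_kernel a%:C b%:C p).
Proof. by have := normc_beta_kernel a%:C b%:C p => /= <-; exact: normc_ge0. Qed.

Lemma EFin_Rintegral (D : set R) (f : R -> R) : measurable D ->
  mu.-integrable D (EFin \o f) ->
  (\int[mu]_(t in D) (f t)%:E = (\int[mu]_(t in D) f t)%:E)%E.
Proof.
by move=> mD intf; rewrite /Rintegral fineK//; apply: integrable_fin_num.
Qed.

(** The modulus of the kernel is the kernel with the real parts of the
    parameters, so Tonelli's theorem and the Gamma integrals at real points give
    integrability. *)
Lemma integrable_beta_kernel (a b : R) : 0 < a -> 0 < b ->
  (mu \x mu)%E.-integrable setT (EFin \o (fun p => Re (beta_kernel a%:C b%:C p))).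
Proof.
move=> a0 b0; apply/integrable12ltyP.
  by apply/measurable_EFinP; have [] := cmeasurable_beta_kernel a%:C b%:C.
have mRp : measurable Rp by exact: measurable_itv.
have [[iG _] _] : cintegrable setT (fun t =>
    if t \in Rp then euler_Gamma a%:C * gamma_fun b%:C t else 0) /\ True.
  split => //; apply/(cintegrable_mkcond _ mRp).
  by apply: (cintegrableZl _ mRp _).1; exact: cintegrable_gamma_fun.
rewrite (_ : (fun t => _) = (fun t => (Re (if t \in Rp
    then euler_Gamma a%:C * gamma_fun b%:C t else 0))%:E)).
  by rewrite EFin_Rintegral// ltry.
apply/funext => t.
have [[ir _] <-] := @beta_kernel_slice1 a%:C b%:C t a0.
rewrite /cintegral/= -EFin_Rintegral//.
by apply: eq_integral => v _ /=; rewrite ger0_norm// Re_beta_kernel_ge0.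
Qed.


Lemma measurable_itvoo (a b : R) : measurable (`]a, b[%classic : set R).
Proof. exact: measurable_itv. Qed.

(** Almost every slice of an integrable kernel is integrable, hence so is the
    one at some height [v > 0]; the others follow by scaling. *)
Lemma cintegrable_beta_integrand z w : 0 < Re z -> 0 < Re w ->
  cintegrable `]0, 1[ (beta_integrand z w).
Proof.
move=> z0 w0; set a := Re z in z0; set b := Re w in w0.
have [v v0 iv] : exists2 v : R, 0 < v &
    mu.-integrable setT (EFin \o (fun t => Re (beta_kernel a%:C b%:C (t, v)))).
  have [N [mN N0 NN]] := ae_integrable2 (integrable_beta_kernel z0 w0).
  have [sub|] := pselect (`]0, 1[%classic `<=` N).
    have : (mu (`]0%R, 1%R[%classic : set R) <= mu N)%E by apply: le_measure; rewrite ?inE.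
    by rewrite [X in (_ <= X)%E]N0 lebesgue_measure_itv/= lte_fin ltr01 -EFinB
      lee_fin subr0 ler10.
  move=> /existsNP[v /not_implyP[+ vN]]; rewrite /= in_itv/= => /andP[v0 _].
  by exists v => //; apply: contrapT => nv; apply: vN; apply: NN.
have m0v := measurable_itvoo 0 v; have m01 := measurable_itvoo 0 1.
have iv' : mu.-integrable (`]0, v[%classic : set R)
    (EFin \o (fun t => Re (beta_kernel a%:C b%:C (t, v)))).
  by apply: integrableS iv.
have [+ _] := integral_affine 0 v0 m0v iv'.
rewrite (_ : _ @^-1` _ = `]0, 1[%classic); last first.
  apply/seteqP; split => t/=; rewrite !in_itv/= addr0 pmulr_rgt0//;
    by rewrite gtr_pMr.
move=> i1.
pose C := (v `^ (a - 1) * v `^ (b - 1) * expR (- v))^-1.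
have iC : mu.-integrable (`]0, 1[%classic : set R)
    (EFin \o (fun t => C * Re (beta_kernel a%:C b%:C (v * t + 0, v)))).
  by under [EFin \o _]eq_fun do rewrite /= EFinM; apply: integrableZl.
apply: (cintegrable_le _ _ iC) => //; first exact: cmeasurable_beta_integrand.
move=> t t01; have /andP[t0 t1] : 0 < t < 1 by move: t01; rewrite /= in_itv.
have vt : v * t < v by rewrite gtr_pMr.
have kE : beta_kernel z w (v * t + 0, v) =
    cpow (v - v * t) (z - 1) * cpow (v * t) (w - 1) * (expR (- v))%:C.
  by rewrite /beta_kernel/= addr0 mulr_gt0// vt.
rewrite -(normc_beta_kernel z w) kE.
rewrite /beta_integrand (_ : v - v * t = v * (1 - t)); last by ring.
rewrite [X in X <= _]ComplexField.Normc.normcM [X in _ <= _ * X]ComplexField.Normc.normcM.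
rewrite [X in _ <= _ * (X * _)]ComplexField.Normc.normcM.
rewrite !normc_cpow normc_real (ger0_norm (expR_ge0 _)).
rewrite !Re_sub/= -/a -/b !powRM ?subr_ge0 ?(ltW v0) ?(ltW t0) ?(ltW t1)//.
have n1 := lt0r_neq0 (powR_gt0 (a - 1) v0).
have n2 := lt0r_neq0 (powR_gt0 (b - 1) v0).
have n3 := lt0r_neq0 (expR_gt0 (- v)).
rewrite le_eqVlt; apply/orP; left; apply/eqP; rewrite /C.
by field; rewrite n1 n2 n3.
Qed.

(** The substitution [t = a + (x - a) u] brings this to the interval [(0, 1)]. *)
Lemma cintegral_beta_itv z w (a x : R) : 0 < Re z -> 0 < Re w -> a < x ->
  cintegrable `]a, x[ (fun t => cpow (x - t) (z - 1) * cpow (t - a) (w - 1)) /\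
  cintegral `]a, x[ (fun t => cpow (x - t) (z - 1) * cpow (t - a) (w - 1)) =
    cpow (x - a) (z + w - 1) * complex_beta z w.
Proof.
move=> z0 w0 ax; have xa0 : 0 < x - a by rewrite subr_gt0.
have m01 := measurable_itvoo 0 1; have max := measurable_itvoo a x.
have k0 : 0 < (x - a)^-1 by rewrite invr_gt0.
have [] := cintegral_affine (- (a / (x - a))) k0 m01 (cintegrable_beta_integrand z0 w0).
rewrite (_ : _ @^-1` _ = `]a, x[%classic); last first.
  by apply/seteqP; split => t/=; rewrite !in_itv/= mulrC -mulrBl
    pmulr_lgt0// ltr_pdivrMr// mul1r subr_gt0 ltrD2r.
move=> i1 e1.
have [i2 e2] := cintegrableZl (cpow (x - a) (z - 1) * cpow (x - a) (w - 1)) max i1.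
have E t : t \in `]a, x[%classic -> cpow (x - a) (z - 1) * cpow (x - a) (w - 1) *
    beta_integrand z w ((x - a)^-1 * t - a / (x - a)) =
    cpow (x - t) (z - 1) * cpow (t - a) (w - 1).
  rewrite inE/= in_itv/= => /andP[at0 tx]; rewrite /beta_integrand.
  have -> : 1 - ((x - a)^-1 * t - a / (x - a)) = (x - t) / (x - a).
    by field; rewrite gt_eqF.
  have -> : (x - a)^-1 * t - a / (x - a) = (t - a) / (x - a).
    by field; rewrite gt_eqF.
  rewrite mulrACA -!cpowMl ?divr_gt0 ?subr_gt0//.
  by congr (cpow _ _ * cpow _ _); field; rewrite gt_eqF.
split; first exact: eq_cintegrable E i2.
rewrite -(eq_cintegral E) e2 /complex_beta e1 mulrA; congr (_ * _).
rewrite (_ : z + w - 1 = (z - 1) + (w - 1) + 1); last by ring.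
rewrite !cpowD// [cpow _ 1]cpow1// -[RHS]mulrA -rmorphM/=.
by rewrite mulfV ?gt_eqF// mulr1.
Qed.

End BetaIntegral.

Section BetaGamma.
Variable R : realType.
Local Notation mu := (@lebesgue_measure R).
Local Notation Rp := (`]0%R, +oo[%classic : set R).
Implicit Types (t v x : R) (z w : R[i]).

Lemma beta_kernel_slice2 z w v : 0 < Re z -> 0 < Re w ->
  cintegrable setT (fun t => beta_kernel z w (t, v)) /\
  cintegral setT (fun t => beta_kernel z w (t, v)) =
    if v \in Rp then complex_beta z w * gamma_fun (z + w) v else 0.
Proof.
move=> z0 w0; case: ifPn => [|/negP]; rewrite inE.
  move=> /in0y v0.
  have m0v := measurable_itvoo 0 v.
  have [ia ea] := cintegral_beta_itv z0 w0 v0.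
  have [iZ eZ] := cintegrableZl (expR (- v))%:C m0v ia.
  have E t : beta_kernel z w (t, v) = if t \in `]0, v[%classic
      then (expR (- v))%:C * (cpow (v - t) (z - 1) * cpow (t - 0) (w - 1)) else 0.
    rewrite /beta_kernel/= subr0 [_ * (_ * _)]mulrC.
    by congr (if _ then _ else _); rewrite mem_setE in_itv.
  split.
    by under [fun t => _]eq_fun do rewrite E; apply/(cintegrable_mkcond _ m0v).
  under [fun t => _]eq_fun do rewrite E.
  rewrite -cintegral_mkcond eZ ea subr0 /gamma_fun; ring.
move=> /in0y/negP; rewrite -leNgt => v0.
have E t : beta_kernel z w (t, v) = 0.
  rewrite /beta_kernel/=; case: ifP => // /andP[t0 tv].
  by have := lt_trans t0 tv; rewrite ltNge v0.
under [fun v => _]eq_fun do rewrite E.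
split; first by split => /=; exact: integrable0.
by rewrite /cintegral/= Rintegral_cst// mul0r.
Qed.

(** Integrability is asked of every slice and not only of almost every one: the
    two components of an iterated [cintegral] have to be compared with
    extended-real integrals, slice by slice. *)
Lemma cintegral_Fubini (F : R * R -> R[i]) (g : R * R -> R) :
  cmeasurable [set: R * R] F -> (mu \x mu)%E.-integrable setT (EFin \o g) ->
  (forall p, normc (F p) <= g p) ->
  (forall t, cintegrable setT (fun v => F (t, v))) ->
  (forall v, cintegrable setT (fun t => F (t, v))) ->
  cintegral setT (fun t => cintegral setT (fun v => F (t, v))) =
  cintegral setT (fun v => cintegral setT (fun t => F (t, v))).
Proof.
move=> [mFr mFi] ig Fg i1 i2.
have H (G : R * R -> R) : measurable_fun setT G -> (forall p, `|G p| <= g p) ->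
    (forall t, mu.-integrable setT (EFin \o (fun v => G (t, v)))) ->
    (forall v, mu.-integrable setT (EFin \o (fun t => G (t, v)))) ->
    \int[mu]_(t in setT) \int[mu]_(v in setT) G (t, v) =
    \int[mu]_(v in setT) \int[mu]_(t in setT) G (t, v).
  move=> mG Gg j1 j2.
  have iG : (mu \x mu)%E.-integrable setT (EFin \o G).
    apply: le_integrable ig => //; first exact/measurable_EFinP.
    by move=> p _ /=; rewrite lee_fin (le_trans (Gg p))// ler_norm.
  rewrite [LHS]/Rintegral [RHS]/Rintegral; congr fine.
  transitivity (\int[mu]_t \int[mu]_v (EFin \o G) (t, v))%E.
    by apply: eq_integral => t _; rewrite -EFin_Rintegral.
  rewrite (Fubini iG).
  by apply: eq_integral => t _; rewrite -EFin_Rintegral.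
apply: complexP.
  apply: (H (fun p => Re (F p))) => //; first by move=> p; exact: le_trans (normc_Re _) (Fg p).
    by move=> t; have [] := i1 t.
  by move=> v; have [] := i2 v.
apply: (H (fun p => Im (F p))) => //; first by move=> p; exact: le_trans (normc_Im _) (Fg p).
  by move=> t; have [] := i1 t.
by move=> v; have [] := i2 v.
Qed.

(** Both sides are the integral of [(v - t)^(z-1) t^(w-1) e^(-v)] over the
    sector [0 < t < v], computed by slices in the two directions. *)
Lemma euler_Gamma_beta z w : 0 < Re z -> 0 < Re w ->
  euler_Gamma z * euler_Gamma w = complex_beta z w * euler_Gamma (z + w).
Proof.
move=> z0 w0.
have mRp : measurable Rp by exact: measurable_itv.
have zw0 : 0 < Re (z + w) by rewrite Re_add addr_gt0.
have ik : (mu \x mu)%E.-integrable setT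
    (EFin \o (fun p => Re (beta_kernel (Re z)%:C (Re w)%:C p))).
  exact: integrable_beta_kernel.
have kg p : normc (beta_kernel z w p) <= Re (beta_kernel (Re z)%:C (Re w)%:C p).
  by rewrite normc_beta_kernel.
transitivity (cintegral setT (fun t => cintegral setT (fun v => beta_kernel z w (t, v)))).
  rewrite -(cintegrableZl _ mRp (cintegrable_gamma_fun w0)).2 cintegral_mkcond.
  by congr (cintegral _ _); apply/funext => t; exact/esym/(beta_kernel_slice1 w t z0).2.
transitivity (cintegral setT (fun v => cintegral setT (fun t => beta_kernel z w (t, v)))).
  apply: (cintegral_Fubini (cmeasurable_beta_kernel z w) ik kg) => t.
    exact: (beta_kernel_slice1 w t z0).1.
  exact: (beta_kernel_slice2 t z0 w0).1.
rewrite -(cintegrableZl _ mRp (cintegrable_gamma_fun zw0)).2 [RHS]cintegral_mkcond.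
by congr (cintegral _ _); apply/funext => v; exact: (beta_kernel_slice2 v z0 w0).2.
Qed.

End BetaGamma.

(** * Zeros of Gamma and the reciprocal Gamma function *)

Section GammaNonvanishing.
Variable R : realType.
Local Notation mu := (@lebesgue_measure R).
Local Notation Rp := (`]0%R, +oo[%classic : set R).
Implicit Types (t x y c u : R) (z w : R[i]).

Lemma normr_sin_le y : `|sin y| <= `|y|.
Proof.
wlog y0 : y / 0 < y.
  move=> H; have [y0|y0|<-] := ltgtP 0 y; first exact: H.
    by have := H (- y); rewrite oppr_gt0 sinN !normrN => /(_ y0).
  by rewrite sin0.
have [|c _] := @MVT R sin cos 0 y y0 (fun t _ => is_derive_sin t).
  by apply: continuous_subspaceT; exact: continuous_sin.
rewrite sin0 !subr0 => ->; rewrite normrM ler_piMl// ?cos_max//.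
Qed.

Lemma cos_ge y : 1 - y ^+ 2 / 2 <= cos y.
Proof.
set s := y / 2; have -> : y = s + s by rewrite /s -splitr.
have h : sin s ^+ 2 <= s ^+ 2.
  by rewrite -[leLHS]real_normK ?num_real// -[leRHS]real_normK ?num_real//
    lerXn2r ?nnegrE// normr_sin_le.
rewrite cosD -!expr2 cos2sin2.
have -> : (s + s) ^+ 2 / 2 = s ^+ 2 + s ^+ 2 by field.
lra.
Qed.

(** With [u = e ^ (2 s)] this is [|s| <= |e ^ s - e ^ (- s)|]. *)
Lemma ln_sqr_le u : 0 < u -> ln u ^+ 2 <= 4 * (u + u^-1 - 2).
Proof.
move=> u0; pose s := ln u / 2; pose v := expR s; pose w := expR (- s).
have vw : v * w = 1 by rewrite /v /w expRxMexpNx_1.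
have -> : ln u = 2 * s by rewrite /s; field.
have -> : u = v * v by rewrite /v -expRD /s -splitr lnK.
have -> : (v * v)^-1 = w * w.
  apply: (@mulfI _ (v * v)); first by rewrite mulf_neq0 ?gt_eqF ?expR_gt0.
  by rewrite mulfV ?mulf_neq0 ?gt_eqF ?expR_gt0// mulrACA vw mulr1.
have sv := expR_ge1Dx s; have sw := expR_ge1Dx (- s).
rewrite -/v in sv; rewrite -/w in sw.
have v0 : 0 < v by exact: expR_gt0.
have w0 : 0 < w by exact: expR_gt0.
have [s0|s0] := leP 0 s.
  have : w <= 1 by rewrite /w expR_le1 oppr_le0.
  move=> w1; have : s ^+ 2 <= (v - w) ^+ 2 by rewrite lerXn2r// ?nnegrE; lra.
  by rewrite !expr2; nra.
have : v <= 1 by rewrite /v expR_le1 ltW.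
move=> v1; have : (- s) ^+ 2 <= (w - v) ^+ 2 by rewrite lerXn2r// ?nnegrE; lra.
by rewrite !expr2; nra.
Qed.

Definition real_Gamma x := \int[mu]_(t in Rp) rgamma x t.

Lemma gamma_fun_real x t : gamma_fun x%:C t = (rgamma x t)%:C.
Proof.
rewrite /gamma_fun (_ : x%:C - 1 = (x - 1)%:C); last by rewrite rmorphB.
by rewrite cpow_real -rmorphM.
Qed.

Lemma real_GammaS x : 0 < x -> real_Gamma (x + 1) = x * real_Gamma x.
Proof.
have E y : real_Gamma y = Re (euler_Gamma y%:C).
  by apply: eq_Rintegral => t _; rewrite -/(gamma_fun _ _) gamma_fun_real.
move=> x0; rewrite !E (_ : (x + 1)%:C = x%:C + 1); last by rewrite rmorphD.
by rewrite euler_GammaS// Re_mul/= mul0r subr0.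
Qed.

Lemma real_Gamma_gt0 x : 1 <= x -> 0 < real_Gamma x.
Proof.
move=> x1; have x0 : 0 < x by exact: lt_le_trans x1.
have iG := integrable_rgamma x0.
pose D := (`]1, 2[%classic : set R).
have mD : measurable D by exact: measurable_itv.
have mRp : measurable Rp by exact: measurable_itv.
have DRp : D `<=` Rp.
  by move=> t; rewrite /D /= !in_itv/= => /andP[/(lt_trans ltr01) ->].
rewrite -lte_fin /real_Gamma -EFin_Rintegral//.
apply: (@lt_le_trans _ _ (\int[mu]_(t in D) (expR (- 2))%:E)%E).
  rewrite integral_cst//= /D lebesgue_measure_itv/= lte_fin ltr1n -EFinB -EFinM.
  by rewrite lte_fin mulr_gt0 ?expR_gt0// subr_gt0 ltr1n.
apply: (@le_trans _ _ (\int[mu]_(t in D) (rgamma x t)%:E)%E).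
  apply: ge0_le_integral => //.
  - by apply/measurable_EFinP; apply: measurable_rgamma.
  - move=> t; rewrite /D /= in_itv/= => /andP[t1 t2]; rewrite lee_fin.
    rewrite -[leLHS]mul1r; apply: ler_pM; rewrite ?expR_ge0//.
      rewrite -[leLHS](powRr0 t); apply: ler_powR; first exact: ltW.
      by rewrite subr_ge0.
    by rewrite ler_expR lerN2 ltW.
apply: ge0_subset_integral => //.
  by apply/measurable_EFinP; apply: measurable_rgamma.
by move=> t _; rewrite lee_fin rgamma_ge0.
Qed.

Lemma Re_rotated_gamma_fun z c t : 0 < c -> 0 < t ->
  Re (cpow c (0 -i* Im z) * gamma_fun z t) =
  rgamma (Re z) t * cos (Im z * (ln t - ln c)).
Proof.
move=> c0 t0; rewrite /gamma_fun mulrA Re_mul [Im _%:C]/(0 : R) mulr0 subr0 Re_mul.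
rewrite !Re_cpow !Im_cpow/= powRr0 Re_sub Im_sub subr0/= /rgamma.
rewrite mulrBr cosB mulNr cosN sinN; ring.
Qed.

(** For large real part the mass of [t^(x-1) e^(-t)] concentrates around
    [t = x], where [t^(iy)] is nearly the constant [x^(iy)]; so after a rotation
    the integrand of [Gamma (x + iy)] has positive mean real part. *)
Lemma euler_Gamma_neq0_far z : 2 * Im z ^+ 2 < Re z - 1 -> euler_Gamma z != 0.
Proof.
move=> hz; set x := Re z in hz *; set y := Im z in hz *.
have y2 : 0 <= y ^+ 2 by exact: sqr_ge0.
have x1 : 1 < x by lra.
have x0 : 0 < x by lra.
have xm0 : 0 < x - 1 by lra.
have mRp : measurable Rp by exact: measurable_itv.
pose c := cpow x (0 -i* y).
have [iR eR] := Re_cintegral c mRp (cintegrable_gamma_fun x0).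
suff : 0 < Re (c * euler_Gamma z).
  by apply: contraTneq => ->; rewrite mulr0 ltxx.
rewrite euler_GammaE eR.
have i1 := integrable_rgamma x0.
have i2 := integrable_rgamma (addr_gt0 x0 ltr01).
have i3 := integrable_rgamma xm0.
have iZ (k : R) (h : R -> R) : mu.-integrable Rp (EFin \o h) ->
    mu.-integrable Rp (EFin \o (fun t => k * h t)).
  by move=> ih; under [EFin \o _]eq_fun do rewrite /= EFinM; apply: integrableZl.
have iD (h k : R -> R) : mu.-integrable Rp (EFin \o h) ->
    mu.-integrable Rp (EFin \o k) ->
    mu.-integrable Rp (EFin \o (fun t => h t + k t)).
  by move=> ih ik; under [EFin \o _]eq_fun do rewrite /= EFinD; apply: integrableD.
(* [cos (y ln (t / x)) >= 1 - 2 y^2 (t / x + x / t - 2)]; the mean of the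
   right-hand side is computed with [t], [1] and [1 / t] absorbed into the Gamma
   integrals at [x + 1], [x] and [x - 1]. *)
pose A := 1 + 4 * y ^+ 2; pose B := - (2 * y ^+ 2 / x); pose C := - (2 * y ^+ 2 * x).
pose h t := A * rgamma x t + (B * rgamma (x + 1) t + C * rgamma (x - 1) t).
have iA := iZ A _ i1; have iB := iZ B _ i2; have iC := iZ C _ i3.
have iBC := iD _ _ iB iC.
have ih : mu.-integrable Rp (EFin \o h) by exact: iD iA iBC.
have lb t : Rp t -> h t <= Re (c * gamma_fun z t).
  move=> /in0y t0; rewrite /c Re_rotated_gamma_fun// -/x -/y -ln_div ?posrE//.
  have e2 : rgamma (x + 1) t = rgamma x t * t.
    by rewrite /rgamma addrK -(mulr_powRB1 (ltW t0) x0); ring.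
  have e3 : rgamma (x - 1) t = rgamma x t / t.
    rewrite /rgamma -(mulr_powRB1 (ltW t0) xm0).
    by field; rewrite gt_eqF.
  rewrite /h e2 e3.
  have -> : A * rgamma x t + (B * (rgamma x t * t) + C * (rgamma x t / t)) =
      rgamma x t * (1 - 2 * y ^+ 2 * (t / x + (t / x)^-1 - 2)).
    by rewrite /A /B /C; field; rewrite !gt_eqF.
  rewrite ler_wpM2l ?rgamma_ge0//; apply: le_trans (cos_ge _).
  have := ln_sqr_le (divr_gt0 t0 x0); rewrite exprMn.
  set L := ln _ ^+ 2; set M := _ - 2; nra.
apply: (@lt_le_trans _ _ (\int[mu]_(t in Rp) h t)); last by apply: le_Rintegral.
rewrite /h RintegralD// RintegralD// !RintegralZl//.
rewrite -!/(real_Gamma _) real_GammaS//.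
have g0 : 0 < real_Gamma x by exact/real_Gamma_gt0/ltW.
have -> : real_Gamma (x - 1) = real_Gamma x / (x - 1).
  have := real_GammaS xm0; rewrite subrK => ->.
  by field; rewrite gt_eqF.
have -> : A * real_Gamma x + (B * (x * real_Gamma x) + C * (real_Gamma x / (x - 1))) =
    real_Gamma x * (1 - 2 * y ^+ 2 / (x - 1)).
  by rewrite /A /B /C; field; rewrite !gt_eqF.
by rewrite mulr_gt0// subr_gt0 ltr_pdivrMr// mul1r.
Qed.

Lemma pochhammerSr (A : pzRingType) (a : A) n :
  pochhammer a n.+1 = pochhammer a n * (a + n%:R).
Proof. by rewrite /pochhammer big_ord_recr. Qed.

Lemma euler_GammaD z n : 0 < Re z ->
  euler_Gamma (z + n%:R) = pochhammer z n * euler_Gamma z.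
Proof.
move=> z0; elim: n => [|n IH]; first by rewrite addr0 /pochhammer big_ord0 mul1r.
rewrite -addn1 natrD addrA euler_GammaS ?IH; last first.
  by rewrite Re_add Re_nat ltr_pwDl.
by rewrite addn1 pochhammerSr; ring.
Qed.

(** A zero would propagate to all [z + n] by the functional equation, and these
    reach the region of the previous non-vanishing lemma. *)
Lemma euler_Gamma_neq0 z : 0 < Re z -> euler_Gamma z != 0.
Proof.
move=> z0; pose n := (Num.truncn (2 * Im z ^+ 2 + 1)).+1.
have : euler_Gamma (z + n%:R) != 0.
  apply: euler_Gamma_neq0_far; rewrite Re_add Im_add Re_nat Im_nat addr0.
  by have := truncnS_gt (2 * Im z ^+ 2 + 1); rewrite -/n; lra.
by rewrite euler_GammaD// mulf_eq0 negb_or => /andP[].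
Qed.

Lemma pochhammer_neq0 z n : 0 < Re z -> pochhammer z n != 0.
Proof.
move=> z0; apply/prodf_neq0 => k _; apply/eqP => /(congr1 (fun w => Re w)).
by rewrite Re_add Re_nat/= => h; have := ltr_pwDl z0 (ler0n R k); rewrite h ltxx.
Qed.

Lemma pochhammerD (A : pzRingType) (a : A) n k :
  pochhammer a (n + k) = pochhammer a n * pochhammer (a + n%:R) k.
Proof.
elim: k => [|k IH]; first by rewrite addn0 /pochhammer big_ord0 mulr1.
by rewrite addnS !pochhammerSr IH natrD !mulrA addrA.
Qed.

Lemma Gamma_shift_gt0 z : 0 < Re (z + (Gamma_shift z)%:R).
Proof.
rewrite Re_add Re_nat /Gamma_shift; case: ifPn => [|_]; first by rewrite addr0.
by have := truncnS_gt (- Re z); lra.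
Qed.

(** Any shift into the right half-plane computes the reciprocal Gamma function,
    since the factors gained in numerator and denominator cancel. *)
Lemma rGamma_shift z n : 0 < Re (z + n%:R) ->
  rGamma z = pochhammer z n / euler_Gamma (z + n%:R).
Proof.
have H p q : 0 < Re (z + p%:R) -> (p <= q)%N ->
    pochhammer z p / euler_Gamma (z + p%:R) = pochhammer z q / euler_Gamma (z + q%:R).
  move=> p0 /subnKC <-; rewrite pochhammerD natrD addrA (euler_GammaD (q - p) p0).
  have := euler_Gamma_neq0 p0; have := pochhammer_neq0 (q - p) p0.
  by move=> h1 h2; field; rewrite h1 h2.
move=> n0; have g0 := Gamma_shift_gt0 z.
by rewrite /rGamma; case: (leqP n (Gamma_shift z)) => [|/ltnW] le; rewrite (H _ _ _ le).
Qed.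

Lemma rGamma_gt0 z : 0 < Re z -> rGamma z = (euler_Gamma z)^-1.
Proof.
by move=> z0; rewrite (@rGamma_shift z 0) ?addr0// /pochhammer big_ord0 mul1r.
Qed.

Lemma pochhammerSl (A : pzRingType) (a : A) n :
  pochhammer a n.+1 = a * pochhammer (a + 1) n.
Proof. by rewrite -add1n pochhammerD /pochhammer big_ord1 addr0. Qed.

(** Both sides are computed through one shift far into the right half-plane,
    which makes the identity valid at the poles of Gamma too. *)
Lemma rGammaS z : rGamma z = z * rGamma (z + 1).
Proof.
pose n := Gamma_shift (z + 1); have n0 := Gamma_shift_gt0 (z + 1).
have E : z + n.+1%:R = z + 1 + n%:R by rewrite -add1n natrD addrA.
rewrite (@rGamma_shift z n.+1) ?E// (@rGamma_shift (z + 1) n)//.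
by rewrite pochhammerSl mulrA.
Qed.

(** The Beta relation divided by the three Gamma values, none of which
    vanishes. *)
Lemma rGamma_beta z w : 0 < Re z -> 0 < Re w ->
  rGamma z * complex_beta z w * rGamma w = rGamma (z + w).
Proof.
move=> z0 w0; have zw0 : 0 < Re (z + w) by rewrite Re_add addr_gt0.
rewrite !rGamma_gt0//.
have h1 := euler_Gamma_neq0 z0; have h2 := euler_Gamma_neq0 w0.
have h3 := euler_Gamma_neq0 zw0.
have -> : complex_beta z w = euler_Gamma z * euler_Gamma w / euler_Gamma (z + w).
  by rewrite euler_Gamma_beta// mulfK.
by field; rewrite h1 h2 h3.
Qed.

(** The fractional integral of a power: the computation to which the theorem
    reduces term by term. *)
Lemma rGamma_cintegral_pow z w (a x : R) : 0 < Re z -> 0 < Re w -> a < x ->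
  rGamma z * cintegral `]a, x[ (fun t => cpow (x - t) (z - 1) * cpow (t - a) (w - 1)) *
    rGamma w = cpow (x - a) (z + w - 1) * rGamma (z + w).
Proof.
move=> z0 w0 ax; rewrite (cintegral_beta_itv z0 w0 ax).2 -rGamma_beta//.
ring.
Qed.

End GammaNonvanishing.

(** * Convergence of the Prabhakar series *)

Section ComplexSeries.
Variable R : realType.
Implicit Types (u g : nat -> R[i]) (l z : R[i]).

(** Convergence is stated through real coordinates because the integrals and
    derivatives of complex functions are defined that way. *)
Definition ccvg u l :=
  (Re (u n) @[n --> \oo] --> Re l) /\ (Im (u n) @[n --> \oo] --> Im l).

Lemma ccvg_unique u l l' : ccvg u l -> ccvg u l' -> l = l'.
Proof.
move=> [h1 h2] [k1 k2]; apply: complexP.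
  exact: cvg_unique h1 k1.
exact: cvg_unique h2 k2.
Qed.

Lemma ccvgZ u l z : ccvg u l -> ccvg (fun n => z * u n) (z * l).
Proof.
move=> [h1 h2]; split.
  under eq_fun do rewrite Re_mul; rewrite Re_mul.
  by apply: cvgB; apply: cvgM => //; exact: cvg_cst.
under eq_fun do rewrite Im_mul; rewrite Im_mul.
by apply: cvgD; apply: cvgM => //; exact: cvg_cst.
Qed.

Lemma ccvg_normc0 u : normc (u n) @[n --> \oo] --> 0 -> ccvg u 0.
Proof.
move=> h; split; apply: norm_cvg0; apply: (squeeze_cvgr _ (cvg_cst 0) h);
  apply: nearW => n; rewrite normr_ge0/=; [exact: normc_Re|exact: normc_Im].
Qed.

Lemma normc_ccvg0 u : ccvg u 0 -> normc (u n) @[n --> \oo] --> 0.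
Proof.
move=> [h1 h2].
have h : `|Re (u n)| + `|Im (u n)| @[n --> \oo] --> 0.
  by rewrite -(addr0 0); apply: cvgD; [rewrite -[X in _ --> X](normr0 R)
    |rewrite -[X in _ --> X](normr0 R)]; exact: cvg_norm.
apply: (squeeze_cvgr _ (cvg_cst 0) h); apply: nearW => n.
by rewrite normc_ge0/= normc_le.
Qed.

Lemma normc_sum_le (n : nat) g :
  normc (\sum_(0 <= k < n) g k) <= \sum_(0 <= k < n) normc (g k).
Proof.
elim: n => [|n IH]; first by rewrite !big_geq// ComplexField.Normc.normc0.
by rewrite !big_nat_recr//= (le_trans (le_normcD _ _))// lerD2r.
Qed.

Definition csummable g := cvgn (series (fun n => normc (g n))).

Definition csum g : R[i] :=
  limn (series (fun n => Re (g n))) +i* limn (series (fun n => Im (g n))).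

Lemma csummable_cvg g : csummable g ->
  ccvg (fun n => \sum_(0 <= k < n) g k) (csum g).
Proof.
move=> sg.
have H (h : nat -> R) : (forall n, `|h n| <= normc (g n)) -> cvgn (series h).
  move=> hg; apply: normed_cvg; apply: (series_le_cvg _ _ hg sg) => n.
    exact: normr_ge0.
  exact: normc_ge0.
split.
  under eq_fun do rewrite Re_sum.
  exact: (H _ (fun n => normc_Re (g n))).
under eq_fun do rewrite Im_sum.
exact: (H _ (fun n => normc_Im (g n))).
Qed.

Lemma csummable_cvgo g : csummable g ->
  series (fun n => g n : R[i]^o) @ \oo --> (csum g : R[i]^o).
Proof. by move=> /csummable_cvg[h1 h2]; exact: cvg_complex. Qed.

Lemma series_normc_le g (n : nat) : csummable g ->
  \sum_(0 <= k < n) normc (g k) <= limn (series (fun k => normc (g k))).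
Proof.
move=> sg; apply: (nondecreasing_cvgn_le _ sg n).
by apply: nondecreasing_series => k *; exact: normc_ge0.
Qed.

(** The ratio test, with the geometric bound [C / 2 ^ n]. *)
Lemma ratio_test (v : nat -> R) : (forall n, 0 <= v n) ->
  (\forall n \near \oo, v n.+1 <= v n / 2) -> cvgn (series v).
Proof.
move=> v0 [N _ hN].
pose C := \sum_(0 <= k < N.+1) v k * 2 ^+ k.
have t0 k : 0 <= v k * 2 ^+ k by rewrite mulr_ge0.
have C0 : 0 <= C by apply: sumr_ge0.
have vC n : v n * 2 ^+ n <= C.
  have [nN|] := leqP n N.
    rewrite /C (bigD1_seq n) ?mem_index_iota ?iota_uniq//= lerDl.
    by apply: sumr_ge0.
  elim: n => // n IH; rewrite ltnS leq_eqVlt => /predU1P[<-|Nn].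
    rewrite exprS mulrA.
    apply: (@le_trans _ _ (v N * 2 ^+ N)).
      rewrite ler_wpM2r ?exprn_ge0//.
      by rewrite -ler_pdivlMr// hN/=.
    rewrite /C (bigD1_seq N) ?mem_index_iota ?iota_uniq ?ltnSn//= lerDl.
    by apply: sumr_ge0.
  apply: le_trans (IH Nn); rewrite exprS mulrA ler_wpM2r ?exprn_ge0//.
  by rewrite -ler_pdivlMr// hN/= // ltnW.
have h : `|2^-1 : R| < 1 by rewrite ger0_norm ?invr_ge0// invf_lt1// ltr1n.
have := is_cvg_geometric_series (a := C) h.
apply: series_le_cvg => // n; first by rewrite mulr_ge0// exprn_ge0// invr_ge0.
by rewrite /geometric/= exprVn ler_pdivlMr// exprn_gt0.
Qed.

End ComplexSeries.

Section PrabhakarCoefficients.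
Variable R : realType.
Local Notation mu := (@lebesgue_measure R).
Implicit Types (m n l z w : R[i]).

(** Dominated convergence applies because the integrand is a fixed Beta
    integrand multiplied by the powers of [t ^ m]. *)
Lemma complex_beta_cvg0 m w : 0 < Re m -> 0 < Re w ->
  normc (complex_beta m (m * u%:R + w)) @[u --> \oo] --> 0.
Proof.
move=> m0 w0; have m01 := @measurable_itvoo R 0 1.
pose g t := normc (beta_integrand m w t).
have h0 : beta_integrand (Re m)%:C (Re w)%:C = (fun t => (g t)%:C).
  apply/funext => t; rewrite /g /beta_integrand ComplexField.Normc.normcM !normc_cpow.
  have E (y : R) : y%:C - 1 = (y - 1)%:C :> R[i] by rewrite rmorphB.
  by rewrite !E !cpow_real -rmorphM !Re_sub.
have ig : mu.-integrable (`]0, 1[%classic : set R) (EFin \o g).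
  by have [] := @cintegrable_beta_integrand _ (Re m)%:C (Re w)%:C m0 w0; rewrite h0.
have bE (u : nat) t : 0 < t ->
    normc (beta_integrand m (m * u%:R + w) t) = g t * (t `^ Re m) ^+ u.
  move=> t0; rewrite /g /beta_integrand -addrA (cpowD (m * u%:R) (w - 1) t0) cpowMn//.
  by rewrite mulrCA ComplexField.Normc.normcM normcX normc_cpow mulrC.
have p1 : (1 : R) `^ Re m = 1 by rewrite powR1.
have b0 t : 0 < t -> t < 1 -> normc (beta_integrand m (m * u%:R + w) t) @[u --> \oo] --> 0.
  move=> t0 t1.
  have -> : (fun u : nat => normc (beta_integrand m (m * u%:R + w) t)) =
      (fun u => g t * (t `^ Re m) ^+ u) by apply/funext => u; rewrite bE.
  rewrite -(mulr0 (g t)); apply: cvgM; first exact: cvg_cst.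
  apply: cvg_expr; rewrite ger0_norm ?powR_ge0//.
  by rewrite -[ltRHS]p1 gt0_ltr_powR// nnegrE ltW.
have [|||_ c1 c2] := @cintegral_dominated _ _
  (fun u => beta_integrand m (m * u%:R + w)) (fun=> 0) g m01
  (fun u => @cmeasurable_beta_integrand R _ m (m * u%:R + w) m01)
  (cmeasurable_cst _ _) _ _ ig.
- by move=> t; rewrite /= in_itv/= => /andP[t0 t1]; have [] := ccvg_normc0 (b0 t t0 t1).
- by move=> t; rewrite /= in_itv/= => /andP[t0 t1]; have [] := ccvg_normc0 (b0 t t0 t1).
- move=> u t; rewrite [_ t]/= in_itv => /andP[t0 t1]; rewrite bE//.
  rewrite ler_piMr ?normc_ge0// exprn_ile1 ?powR_ge0//.
  by rewrite -[leRHS]p1 ge0_ler_powR// ?nnegrE ltW.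
apply: normc_ccvg0; split.
  by move: c1; rewrite /cintegral/= Rintegral_cst// mul0r.
by move: c2; rewrite /cintegral/= Rintegral_cst// mul0r.
Qed.

Lemma normc_nat (u : nat) : normc (u%:R : R[i]) = u%:R.
Proof. by rewrite normc_sqrtE Re_nat Im_nat expr0n addr0 sqrtr_sqr ger0_norm. Qed.

Definition prabhakar_coef m n l (u : nat) : R[i] :=
  pochhammer l u * (u`!%:R)^-1 * rGamma (m * u%:R + n).

(** The quotient of consecutive values of the reciprocal Gamma function along
    [m u + n] is, up to the factor [1 / Gamma(m)], a Beta value that tends to
    [0]; so the radius of convergence is infinite. *)
Lemma prabhakar_coef_summable m n l (rho : R) : 0 < Re m -> 0 <= rho ->
  cvgn (series (fun u => normc (prabhakar_coef m n l u) * rho ^+ u)).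
Proof.
move=> m0 rho0.
(* From the index [N] on, [m u + n] lies in the right half-plane. *)
pose N := (Num.truncn (- (Re n) / Re m)).+1.
pose w := m * N%:R + n.
have w0 : 0 < Re w.
  rewrite /w Re_add Re_mul Re_nat Im_nat mulr0 subr0.
  have := truncnS_gt (- (Re n) / Re m); rewrite -/N ltr_pdivrMr//.
  by rewrite [Re m * _]mulrC; lra.
pose K := (normc l + 1) * rho * normc (rGamma m).
have K0 : 0 <= K by rewrite !mulr_ge0 ?addr_ge0 ?normc_ge0.
have Kb : K * normc (complex_beta m (m * u%:R + w)) @[u --> \oo] --> 0.
  by rewrite -[X in _ --> X](mulr0 K); apply: cvgM; [exact: cvg_cst|exact: complex_beta_cvg0].
apply: ratio_test; first by move=> u; rewrite mulr_ge0 ?normc_ge0 ?exprn_ge0.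
have half : 0 < 2^-1 :> R by rewrite invr_gt0.
have /cvgrPdist_lt/(_ _ half)[M _ hM] := Kb.
exists (N + M)%N => // u /= NMu.
pose v := (u - N)%N.
have uE : u = (v + N)%N by rewrite /v subnK// (leq_trans _ NMu)// leq_addr.
have Mv : (M <= v)%N by rewrite -(leq_add2l N) (leq_trans NMu)// uE addnC.
have wE : m * u%:R + n = m * v%:R + w.
  by rewrite uE natrD mulrDr /w addrA.
have wv0 : 0 < Re (m * v%:R + w).
  rewrite Re_add Re_mul Re_nat Im_nat mulr0 subr0 ltr_wpDl//.
  by rewrite mulr_ge0// ltW.
have hb : K * normc (complex_beta m (m * v%:R + w)) <= 2^-1.
  have := hM v Mv; rewrite /= sub0r normrN ger0_norm; first exact: ltW.
  by rewrite mulr_ge0// normc_ge0.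
rewrite /prabhakar_coef pochhammerSr factS natrM invfM.
rewrite (_ : m * u.+1%:R + n = m * u%:R + n + m); last first.
  by rewrite -addn1 natrD mulrDr mulr1 addrAC.
rewrite wE [_ + w + m]addrC -rGamma_beta//.
set P := pochhammer l u; set F := (u`!%:R)^-1; set G := rGamma (_ + w).
set B := complex_beta _ _ in hb *.
have -> : P * (l + u%:R) * (u.+1%:R^-1 * F) * (rGamma m * B * G) =
    (P * F * G) * ((l + u%:R) / u.+1%:R * rGamma m * B) by ring.
have hY : normc ((l + u%:R) / u.+1%:R * rGamma m * B) * rho <= 2^-1.
  apply: le_trans hb.
  rewrite ComplexField.Normc.normcM mulrAC ler_wpM2r ?normc_ge0//.
  rewrite ComplexField.Normc.normcM mulrAC /K ler_wpM2r ?normc_ge0// ler_wpM2r//.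
  rewrite ComplexField.Normc.normcM ComplexField.Normc.normcV normc_nat.
  rewrite ler_pdivrMr ?ltr0n// (le_trans (le_normcD _ _))// normc_nat.
  rewrite -natr1; have := normc_ge0 l; have := ler0n R u; nra.
rewrite ComplexField.Normc.normcM exprS.
set nX := normc (P * F * G); set nY := normc _ in hY *.
have -> : nX * nY * (rho * rho ^+ u) = nX * rho ^+ u * (nY * rho) by ring.
by rewrite ler_wpM2l// mulr_ge0 ?normc_ge0 ?exprn_ge0.
Qed.

End PrabhakarCoefficients.

(** * Fractional integration of the Prabhakar function *)

Section ComplexPrabhakar.
Variable R : realType.
Local Notation mu := (@lebesgue_measure R).
Implicit Types (m n l r z w zeta alpha : R[i]) (a x t : R).

Definition complex_prabhakar_term m n l zeta (u : nat) : R[i] :=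
  prabhakar_coef m n l u * zeta ^+ u.

Definition complex_prabhakar m n l zeta : R[i] :=
  csum (complex_prabhakar_term m n l zeta).

Lemma normc_prabhakar_term m n l zeta (u : nat) :
  normc (complex_prabhakar_term m n l zeta u) =
  normc (prabhakar_coef m n l u) * normc zeta ^+ u.
Proof. by rewrite ComplexField.Normc.normcM normcX. Qed.

Lemma csummable_prabhakar m n l zeta : 0 < Re m ->
  csummable (complex_prabhakar_term m n l zeta).
Proof.
move=> m0; rewrite /csummable; under eq_fun do rewrite normc_prabhakar_term.
by apply: prabhakar_coef_summable => //; exact: normc_ge0.
Qed.

Lemma cmeasurable_cvg (D : set R) (F : nat -> R -> R[i]) (f : R -> R[i]) :
  (forall N, cmeasurable D (F N)) ->
  (forall t, D t -> ccvg (F ^~ t) (f t)) -> cmeasurable D f.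
Proof.
move=> mF Ff; split.
  apply: (@measurable_fun_cvg _ _ _ _ (fun N t => Re (F N t))) => [N|t Dt].
    exact: (mF N).1.
  exact: (Ff t Dt).1.
apply: (@measurable_fun_cvg _ _ _ _ (fun N t => Im (F N t))) => [N|t Dt].
  exact: (mF N).2.
exact: (Ff t Dt).2.
Qed.

(** Term by term the fractional integral raises the exponent and the argument
    of the reciprocal Gamma function by [alpha]; the partial sums are dominated
    by a constant multiple of the coordinates of their first Beta integrand. *)
Lemma cRL_integral_prabhakar alpha m n l r a x (f : R -> R[i]) :
  0 < Re alpha -> 0 < Re m -> 0 < Re n -> a < x ->
  (forall t, a < t -> f t =
    cpow (t - a) (n - 1) * complex_prabhakar m n l (r * cpow (t - a) m)) ->
  cRL_integral_exists a alpha f x /\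
  cRL_integral a alpha f x = cpow (x - a) (n + alpha - 1) *
    complex_prabhakar m (n + alpha) l (r * cpow (x - a) m).
Proof.
move=> al0 m0 n0 ax fE.
have mD := measurable_itvoo a x; set D := (`]a, x[%classic : set R) in mD *.
have xa0 : 0 < x - a by rewrite subr_gt0.
have w0 (u : nat) : 0 < Re (m * u%:R + n).
  rewrite Re_add Re_mul Re_nat Im_nat mulr0 subr0 ltr_wpDl//.
  by rewrite mulr_ge0// ltW.
pose P w t := cpow (x - t) (alpha - 1) * cpow (t - a) (w - 1).
pose c u := prabhakar_coef m n l u.
pose F N t := \sum_(0 <= u < N) c u * r ^+ u * P (m * u%:R + n) t.
have iP w : 0 < Re w -> cintegrable D (P w) by move=> ?; exact: (cintegral_beta_itv al0 _ ax).1.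
have mP w : cmeasurable D (P w).
  by apply: cmeasurableM; apply: cmeasurable_cpow => //; exact: measurable_funB.
have FE N t : D t -> F N t =
    P n t * \sum_(0 <= u < N) complex_prabhakar_term m n l (r * cpow (t - a) m) u.
  rewrite /D/= in_itv => /andP[at0 tx]; have ta0 : 0 < t - a by rewrite subr_gt0.
  rewrite /F mulr_sumr; apply: eq_bigr => u _.
  rewrite /P -addrA (cpowD (m * u%:R) (n - 1) ta0) cpowMn//.
  by rewrite /complex_prabhakar_term /c [(r * _) ^+ u]exprMn; ring.
have cF t : D t -> ccvg (F ^~ t) (RL_integrand alpha f x t).
  move=> Dt; have := Dt; rewrite {1}/D/= in_itv => /andP[at0 tx].
  rewrite /RL_integrand fE// mulrA -/(P n t) (funext (fun N => FE N t Dt)).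
  by apply: ccvgZ; apply: csummable_cvg; exact: csummable_prabhakar.
have mF N : cmeasurable D (F N).
  by apply: cmeasurable_sum => u; apply: cmeasurableM => //; exact: cmeasurable_cst.
have mf : cmeasurable D (RL_integrand alpha f x) by exact: cmeasurable_cvg mF cF.
pose zeta := r * cpow (x - a) m.
have sz : csummable (complex_prabhakar_term m n l zeta) by exact: csummable_prabhakar.
pose S := limn (series (fun u => normc (complex_prabhakar_term m n l zeta u))).
have S0 : 0 <= S.
  by have := series_normc_le 0 sz; rewrite big_geq.
pose g t := S * (`|Re (P n t)| + `|Im (P n t)|).
have ig : mu.-integrable D (EFin \o g).
  have [ir ii] := iP n n0.
  under [EFin \o _]eq_fun do rewrite /= EFinM EFinD.
  apply: integrableZl => //; apply: integrableD => //.
    by apply: (integrable_norm ir).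
  by apply: (integrable_norm ii).
have Fg N t : D t -> normc (F N t) <= g t.
  move=> Dt; rewrite FE// ComplexField.Normc.normcM /g mulrC.
  apply: ler_pM; [exact: normc_ge0|exact: normc_ge0| |exact: normc_le].
  apply: le_trans (normc_sum_le _ _) _; apply: le_trans (series_normc_le N sz).
  apply: ler_sum => u _; rewrite !normc_prabhakar_term.
  rewrite ler_wpM2l ?normc_ge0// lerXn2r ?nnegrE ?normc_ge0//.
  rewrite [X in X <= _]ComplexField.Normc.normcM [X in _ <= X]ComplexField.Normc.normcM.
  rewrite ler_wpM2l ?normc_ge0// !normc_cpow.
  move: Dt; rewrite /D/= in_itv => /andP[at0 tx].
  by rewrite ge0_ler_powR ?nnegrE ?subr_ge0 ?lerD2r ?ltW.
have [ie cr ci] := cintegral_dominated mD mF mf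
  (fun t Dt => (cF t Dt).1) (fun t Dt => (cF t Dt).2) ig Fg.
split; first exact: ie.
have IE N : rGamma alpha * cintegral D (F N) = cpow (x - a) (n + alpha - 1) *
    \sum_(0 <= u < N) complex_prabhakar_term m (n + alpha) l zeta u.
  rewrite (cintegral_sum N mD (fun u => (cintegrableZl (c u * r ^+ u) mD (iP _ (w0 u))).1)).2.
  rewrite !mulr_sumr; apply: eq_bigr => u _.
  rewrite (cintegrableZl (c u * r ^+ u) mD (iP _ (w0 u))).2.
  have := rGamma_cintegral_pow al0 (w0 u) ax; rewrite -/D -/(P _) => E.
  rewrite /c /complex_prabhakar_term /prabhakar_coef.
  set q := pochhammer l u * _.
  have -> : rGamma alpha * (q * rGamma (m * u%:R + n) * r ^+ u * cintegral D (P (m * u%:R + n))) =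
     q * r ^+ u * (rGamma alpha * cintegral D (P (m * u%:R + n)) * rGamma (m * u%:R + n)) by ring.
  rewrite E /zeta [(r * _) ^+ u]exprMn -cpowMn//.
  have -> : alpha + (m * u%:R + n) - 1 = n + alpha - 1 + m * u%:R by ring.
  rewrite cpowD// (_ : alpha + (m * u%:R + n) = m * u%:R + (n + alpha)); last by ring.
  by ring.
have c1 : ccvg (fun N => rGamma alpha * cintegral D (F N)) (cRL_integral a alpha f x).
  by apply: ccvgZ; split.
apply: ccvg_unique c1 _; rewrite (funext IE).
by apply: ccvgZ; apply: csummable_cvg; exact: csummable_prabhakar.
Qed.

End ComplexPrabhakar.

(** * Termwise differentiation of the Prabhakar series *)

Section TermwiseDerivative.
Variable R : realType.

Lemma MVT_ball (f df : R -> R) (y0 d y : R) :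
  (forall t : R, `|t - y0| < d -> is_derive t 1 f (df t)) -> `|y - y0| < d ->
  exists2 c, `|c - y0| <= `|y - y0| & f y - f y0 = df c * (y - y0).
Proof.
move=> fd yd.
have cf (t : R) : `|t - y0| < d -> {for t, continuous f}.
  move=> td; apply: differentiable_continuous; apply/derivable1_diffP.
  by have [] := fd _ td.
have [yy|yy|->] := ltgtP y0 y; last first.
- by exists y; rewrite // !subrr mulr0.
- have near t : y <= t <= y0 -> `|t - y0| <= `|y - y0|.
    by move=> /andP[h1 h2]; rewrite (@ltr0_norm _ (y - y0)) ?subr_lt0// ler_norml; lra.
  have [t||c] := @MVT R f df y y0 yy.
  + rewrite in_itv/= => /andP[h1 h2]; apply: fd; apply: le_lt_trans yd.
    by apply: near; rewrite !ltW.
  + apply: continuous_in_subspaceT => t; rewrite inE/= in_itv/= => tt.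
    by apply: cf; apply: le_lt_trans yd; exact: near.
  rewrite in_itv/= => /andP[h1 h2] E; exists c; first by apply: near; rewrite !ltW.
  by rewrite -opprB E; ring.
- have near t : y0 <= t <= y -> `|t - y0| <= `|y - y0|.
    by move=> /andP[h1 h2]; rewrite (@gtr0_norm _ (y - y0)) ?subr_gt0// ler_norml; lra.
  have [t||c] := @MVT R f df y0 y yy.
  + rewrite in_itv/= => /andP[h1 h2]; apply: fd; apply: le_lt_trans yd.
    by apply: near; rewrite !ltW.
  + apply: continuous_in_subspaceT => t; rewrite inE/= in_itv/= => tt.
    by apply: cf; apply: le_lt_trans yd; exact: near.
  rewrite in_itv/= => /andP[h1 h2] E; exists c => //.
  by apply: near; rewrite !ltW.
Qed.

(** A uniform bound [M u] on the second derivatives bounds the error of each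
    first-order expansion by [M u * h ^ 2]; these errors can be summed. *)
Lemma is_derive_series (g g1 g2 : nat -> R -> R) (M : nat -> R) (y0 d : R)
    (G : R -> R) (G1 : R) : 0 < d ->
  (forall u (y : R), `|y - y0| < d -> is_derive y 1 (g u) (g1 u y)) ->
  (forall u (y : R), `|y - y0| < d -> is_derive y 1 (g1 u) (g2 u y)) ->
  (forall u (y : R), `|y - y0| < d -> `|g2 u y| <= M u) ->
  cvgn (series M) ->
  (forall y : R, `|y - y0| < d ->
    \sum_(0 <= u < N) g u y @[N --> \oo] --> G y) ->
  \sum_(0 <= u < N) g1 u y0 @[N --> \oo] --> G1 ->
  is_derive y0 1 G G1.
Proof.
move=> d0 dg dg1 bg2 sM gG gG1.
have y0d : `|y0 - y0| < d by rewrite subrr normr0.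
have M0 u : 0 <= M u by exact: le_trans (normr_ge0 _) (bg2 u y0 y0d).
pose S := limn (series M).
have MS N : \sum_(0 <= u < N) M u <= S.
  apply: (nondecreasing_cvgn_le _ sM N).
  by apply: nondecreasing_series => k *; exact: M0.
have S0 : 0 <= S by have := MS 0%N; rewrite big_geq.
have err u y : `|y - y0| < d ->
    `|g u y - g u y0 - (y - y0) * g1 u y0| <= M u * (y - y0) ^+ 2.
  move=> yd; have [c cy ->] := MVT_ball (dg u) yd.
  have cd : `|c - y0| < d by exact: le_lt_trans yd.
  have [c' c'c E] := MVT_ball (dg1 u) cd.
  have c'd : `|c' - y0| < d by exact: le_lt_trans cd.
  have -> : g1 u c * (y - y0) - (y - y0) * g1 u y0 = (g1 u c - g1 u y0) * (y - y0).
    by ring.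
  rewrite E !normrM -mulrA -(real_normK (num_real (y - y0))).
  apply: ler_pM; [exact: normr_ge0|by rewrite mulr_ge0|exact: bg2|].
  by rewrite expr2 ler_wpM2r.
have Err y : `|y - y0| < d ->
    `|G y - G y0 - (y - y0) * G1| <= S * (y - y0) ^+ 2.
  move=> yd.
  have c : `|\sum_(0 <= u < N) g u y - \sum_(0 <= u < N) g u y0 -
      (y - y0) * \sum_(0 <= u < N) g1 u y0| @[N --> \oo] -->
      `|G y - G y0 - (y - y0) * G1|.
    apply: cvg_norm; apply: cvgB; first by apply: cvgB; exact: gG.
    by apply: cvgM => //; exact: cvg_cst.
  rewrite -(cvg_lim _ c)//; apply: limr_le; first by apply/cvg_ex; eexists; exact: c.
  apply: nearW => N; rewrite -sumrB mulr_sumr -sumrB.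
  apply: le_trans (ler_norm_sum _ _ _) _.
  apply: (@le_trans _ _ (\sum_(0 <= u < N) M u * (y - y0) ^+ 2)).
    by apply: ler_sum => u _; exact: err.
  by rewrite -mulr_suml ler_wpM2r// sqr_ge0.
have c : h^-1 *: ((G \o shift y0) (h *: (1 : R)) - G y0) @[h --> (0 : R)^'] --> G1.
  apply/cvgrPdist_le => /= e e0; near=> h.
  have h0 : h != 0 by near: h; exact: nbhs_dnbhs_neq.
  have hd : `|h| < d by near: h; apply: dnbhs0_lt.
  have he : `|h| < e / (S + 1) by near: h; apply: dnbhs0_lt; rewrite divr_gt0// ltr_wpDl.
  rewrite /GRing.scale/= mulr1.
  have := Err (h + y0); rewrite addrK => /(_ hd) H.
  have -> : G1 - h^-1 * (G (h + y0) - G y0) =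
      - (h^-1 * (G (h + y0) - G y0 - h * G1)) by field.
  rewrite normrN normrM normfV ler_pdivrMl ?normr_gt0//.
  apply: le_trans H _; rewrite -(real_normK (num_real h)) expr2 mulrCA.
  rewrite ler_wpM2l//.
  move: he; rewrite ltr_pdivlMr ?ltr_wpDl// => he.
  by have := normr_ge0 h; nra.
split; first by apply/cvg_ex; exists G1; exact: c.
exact: cvg_lim c.
Unshelve. all: by end_near. Qed.

End TermwiseDerivative.

Section PrabhakarDerivative.
Variable R : realType.
Implicit Types (m n l r s z w c : R[i]) (a x y t : R).

Lemma powR_le_itv (p d1 d2 t : R) : 0 < d1 -> d1 <= t -> t <= d2 ->
  t `^ p <= d1 `^ p + d2 `^ p.
Proof.
move=> d0 dt td; have t0 : 0 < t by exact: lt_le_trans dt.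
have d20 : 0 < d2 by exact: lt_le_trans td.
have [p0|p0] := leP 0 p.
  by rewrite ler_wpDl ?powR_ge0// ge0_ler_powR// nnegrE ltW.
rewrite ler_wpDr ?powR_ge0// -[p]opprK !(powRN _ (- p)).
have np0 : 0 <= - p by rewrite oppr_ge0 ltW.
by rewrite lef_pV2 ?posrE ?powR_gt0// ge0_ler_powR// nnegrE ltW.
Qed.

(** The factor produced by differentiating [y ^ (m u + s - 1)] lowers the
    argument of the reciprocal Gamma function by one. *)
Lemma prabhakar_coefB m s l (u : nat) :
  prabhakar_coef m s l u * (m * u%:R + s - 1) = prabhakar_coef m (s - 1) l u.
Proof.
rewrite /prabhakar_coef [rGamma (m * u%:R + (s - 1))]rGammaS addrA subrK.
by ring.
Qed.

Definition prabhakar_pow a m s l r y : R[i] :=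
  cpow (y - a) (s - 1) * complex_prabhakar m s l (r * cpow (y - a) m).

Let pterm a m s l r (c : R[i]) (u : nat) y : R :=
  Re (c * (prabhakar_coef m s l u * r ^+ u) * cpow (y - a) (m * u%:R + s - 1)).

Let is_derive_pterm a m s l r c (u : nat) y : a < y ->
  is_derive y 1 (pterm a m s l r c u) (pterm a m (s - 1) l r c u y).
Proof.
move=> ay; have ya : 0 < y - a by rewrite subr_gt0.
have dsh : is_derive y 1 (fun t : R => t - a) (1 : R).
  have dc := is_deriveB (is_derive_id y (1 : R)) (is_derive_cst a y (1 : R)).
  by apply: (is_derive_eq dc); rewrite subr0.
have dcp := is_derive_cpow (c * (prabhakar_coef m s l u * r ^+ u)) (m * u%:R + s - 1) ya.
have H := is_derive1_comp (f := fun t => Re (_ * cpow t _))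
  (g := fun t : R => t - a) dcp dsh.
apply: (@is_derive_eq _ _ _ (pterm a m s l r c u) _ _ _ _ H).
rewrite mulr1 /pterm -prabhakar_coefB; congr Re.
by rewrite [m * _ + (s - 1)]addrA; ring.
Qed.

Let pterm_sum a m s l r c (N : nat) y : a < y ->
  \sum_(0 <= u < N) pterm a m s l r c u y =
  Re (c * (cpow (y - a) (s - 1) *
    \sum_(0 <= u < N) complex_prabhakar_term m s l (r * cpow (y - a) m) u)).
Proof.
move=> ay; have ya : 0 < y - a by rewrite subr_gt0.
rewrite !mulr_sumr Re_sum; apply: eq_bigr => u _; rewrite /pterm; congr Re.
rewrite -[_ + s - 1]addrA (cpowD (m * u%:R) (s - 1) ya) cpowMn//.
by rewrite /complex_prabhakar_term [(r * _) ^+ u]exprMn; ring.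
Qed.

Let pterm_cvg a m s l r c y : 0 < Re m -> a < y ->
  \sum_(0 <= u < N) pterm a m s l r c u y @[N --> \oo] -->
  Re (c * prabhakar_pow a m s l r y).
Proof.
move=> m0 ay; rewrite (funext (fun N => pterm_sum m s l r c N ay)).
have := csummable_cvg (@csummable_prabhakar R m s l (r * cpow (y - a) m) m0).
by move=> /(ccvgZ (cpow (y - a) (s - 1)))/(ccvgZ c)[].
Qed.

(** With [d = (y - a) / 2], the values [t - a] for [t] within [d] of [y] lie
    between [d] and [3 d], where the second
    derivatives of the terms have a summable bound. *)
Lemma is_derive_prabhakar_pow a m s l r c y : 0 < Re m -> a < y ->
  is_derive y 1 (fun t => Re (c * prabhakar_pow a m s l r t))
    (Re (c * prabhakar_pow a m (s - 1) l r y)).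
Proof.
move=> m0 ay; have ya : 0 < y - a by rewrite subr_gt0.
pose d := (y - a) / 2; have d0 : 0 < d by rewrite divr_gt0.
have near t : `|t - y| < d -> [/\ a < t, d <= t - a & t - a <= 3 * d].
  by rewrite /d ltr_norml => /andP[h1 h2]; split; lra.
pose p := Re s - 3; pose K := d `^ p + (3 * d) `^ p.
pose rho := normc r * (3 * d) `^ Re m.
pose M u := normc c * K * (normc (prabhakar_coef m (s - 1 - 1) l u) * rho ^+ u).
apply: (@is_derive_series R (pterm a m s l r c) (pterm a m (s - 1) l r c)
  (pterm a m (s - 1 - 1) l r c) M y d) => //.
- by move=> u t /near[at0 _ _]; exact: is_derive_pterm.
- by move=> u t /near[at0 _ _]; exact: is_derive_pterm.
- move=> u t /near[at0 t1 t2]; have t0 : 0 < t - a by rewrite subr_gt0.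
  apply: le_trans (normc_Re _) _.
  rewrite ComplexField.Normc.normcM normc_cpow.
  rewrite ComplexField.Normc.normcM [X in _ * X * _]ComplexField.Normc.normcM normcX.
  have -> : Re (m * u%:R + (s - 1 - 1) - 1) = Re m * u%:R + p.
    rewrite Re_sub Re_add !Re_sub Re_mul Re_nat Im_nat mulr0 subr0 /p/=; ring.
  rewrite powRD; last by rewrite (gt_eqF t0) implybT.
  rewrite powRrM powR_mulrn ?powR_ge0// /M /rho exprMn.
  set C := normc c; set Q := normc (prabhakar_coef _ _ _ _); set r1 := normc r ^+ u.
  have e1 : (t - a) `^ p <= K by exact: powR_le_itv.
  have e2 : ((t - a) `^ Re m) ^+ u <= ((3 * d) `^ Re m) ^+ u.
    have h3 : 0 <= 3 * d by rewrite mulr_ge0// ltW.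
    by rewrite lerXn2r ?nnegrE ?powR_ge0// ge0_ler_powR ?nnegrE ?(ltW t0) ?(ltW m0).
  have -> : C * K * (Q * (r1 * ((3 * d) `^ Re m) ^+ u)) =
    C * (Q * r1) * (((3 * d) `^ Re m) ^+ u * K) by ring.
  rewrite ler_wpM2l ?mulr_ge0 ?normc_ge0 ?exprn_ge0 ?normc_ge0//.
  by rewrite ler_pM ?exprn_ge0 ?powR_ge0.
- have rho0 : 0 <= rho by rewrite mulr_ge0 ?normc_ge0 ?powR_ge0.
  have := @prabhakar_coef_summable R m (s - 1 - 1) l rho m0 rho0.
  exact: is_cvg_seriesZ.
- by move=> t /near[at0 _ _]; exact: pterm_cvg.
- exact: pterm_cvg.
Qed.

(** [F] is only known on the open half-line [y > a], which suffices because
    derivatives are local. *)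
Lemma derive1n_prabhakar_pow a m s l r c (F : R -> R) (k : nat) :
  0 < Re m ->
  (forall y, a < y -> F y = Re (c * prabhakar_pow a m s l r y)) ->
  forall y, a < y ->
    derive1n k F y = Re (c * prabhakar_pow a m (s - k%:R) l r y) /\
    derivable (derive1n k F) y 1.
Proof.
move=> m0 FE; elim: k => [|k IH] y ay.
  split; first by rewrite derive1n0 subr0 FE.
  rewrite derive1n0.
  have [+ _] : is_derive y 1 F (Re (c * prabhakar_pow a m (s - 1) l r y)).
    apply: near_eq_is_derive (is_derive_prabhakar_pow s l r c m0 ay).
    by near=> t; apply/esym/FE; near: t; exact: lt_nbhsr.
  by [].
have E (y' : R) : a < y' ->
    is_derive y' 1 (derive1n k F) (Re (c * prabhakar_pow a m (s - k.+1%:R) l r y')).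
  move=> ay'; have := is_derive_prabhakar_pow (s - k%:R) l r c m0 ay'.
  rewrite (_ : s - k%:R - 1 = s - k.+1%:R); last by rewrite -addn1 natrD; ring.
  apply: near_eq_is_derive.
  by near=> t; apply/esym/(IH t _).1; near: t; exact: lt_nbhsr.
split; first by rewrite derive1nS derive1E; have [_ ->] := E y ay.
have [+ _] : is_derive y 1 (derive1n k.+1 F) (Re (c * prabhakar_pow a m (s - k.+1%:R - 1) l r y)).
  apply: near_eq_is_derive (is_derive_prabhakar_pow (s - k.+1%:R) l r c m0 ay).
  near=> t; have at0 : a < t by near: t; exact: lt_nbhsr.
  by rewrite derive1nS derive1E; have [_ ->] := E t at0.
by [].
Unshelve. all: by end_near. Qed.

End PrabhakarDerivative.

(** * Fractional derivatives of the Prabhakar function *)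

Section ComplexRLDerivative.
Variable R : realType.
Implicit Types (m n l r alpha : R[i]).

(** The fractional integral of order [q - alpha] is known on the whole
    half-line [y > a], and each of the [q] ordinary derivatives lowers the
    argument by one. *)
Lemma cRL_derivative_prabhakar alpha m n l r (a x : R) (f : R -> R[i]) :
  0 < Re alpha -> 0 < Re m -> 0 < Re n -> a < x ->
  (forall t, a < t -> f t =
    cpow (t - a) (n - 1) * complex_prabhakar m n l (r * cpow (t - a) m)) ->
  cRL_derivative_exists a alpha f x /\
  cRL_derivative a alpha f x = cpow (x - a) (n - alpha - 1) *
    complex_prabhakar m (n - alpha) l (r * cpow (x - a) m).
Proof.
move=> al0 m0 n0 ax fE.
rewrite /cRL_derivative_exists /cRL_derivative.
set q := RL_order alpha; set F := cRL_integral a (q%:R - alpha) f.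
have qal : 0 < Re (q%:R - alpha).
  by rewrite Re_sub Re_nat subr_gt0; exact: truncnS_gt.
pose s := n + (q%:R - alpha).
have FE y : a < y -> F y = prabhakar_pow a m s l r y.
  by move=> ay; exact: (cRL_integral_prabhakar qal m0 n0 ay fE).2.
have FR y : a < y -> Re (F y) = Re (1 * prabhakar_pow a m s l r y).
  by move=> ay; rewrite mul1r FE.
have ImE (z : R[i]) : Im z = Re ((0 -i* 1) * z) by rewrite Re_mul/=; ring.
have FI y : a < y -> Im (F y) = Re ((0 -i* 1) * prabhakar_pow a m s l r y).
  by move=> ay; rewrite -ImE FE.
split.
  split; first exact: (cRL_integral_prabhakar qal m0 n0 ax fE).1.
  move=> k _; split.
    exact: (derive1n_prabhakar_pow k m0 FR ax).2.
  exact: (derive1n_prabhakar_pow k m0 FI ax).2.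
have sE : s - q%:R = n - alpha by rewrite /s; ring.
rewrite /cderive_n (derive1n_prabhakar_pow q m0 FR ax).1.
rewrite (derive1n_prabhakar_pow q m0 FI ax).1 -ImE mul1r sE.
by rewrite /prabhakar_pow; case: (_ * _).
Qed.

End ComplexRLDerivative.

(** * Idempotent components *)

Section IdempotentComponents.
Variable R : realType.
Implicit Types (xi m n l zeta : bicomplex R).

Lemma idem1_zmod : zmod_morphism (@idem1 R).
Proof. by move=> [? ? ? ?] [? ? ? ?]; congr Complex => /=; ring. Qed.
Lemma idem2_zmod : zmod_morphism (@idem2 R).
Proof. by move=> [? ? ? ?] [? ? ? ?]; congr Complex => /=; ring. Qed.
Lemma idem1_monoid : monoid_morphism (@idem1 R).
Proof.
by split => [|[? ? ? ?] [? ? ? ?]]; congr Complex => /=; ring.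
Qed.
Lemma idem2_monoid : monoid_morphism (@idem2 R).
Proof.
by split => [|[? ? ? ?] [? ? ? ?]]; congr Complex => /=; ring.
Qed.

HB.instance Definition _ := GRing.isZmodMorphism.Build
  (bicomplex R) R[i] (@idem1 R) idem1_zmod.
HB.instance Definition _ := GRing.isZmodMorphism.Build
  (bicomplex R) R[i] (@idem2 R) idem2_zmod.
HB.instance Definition _ := GRing.isMonoidMorphism.Build
  (bicomplex R) R[i] (@idem1 R) idem1_monoid.
HB.instance Definition _ := GRing.isMonoidMorphism.Build
  (bicomplex R) R[i] (@idem2 R) idem2_monoid.

Lemma idem1_of_complex (z : R[i]) : idem1 (bc_of_complex z) = z.
Proof. by case: z => ? ?; congr Complex => /=; ring. Qed.
Lemma idem2_of_complex (z : R[i]) : idem2 (bc_of_complex z) = z.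
Proof. by case: z => ? ?; congr Complex => /=; ring. Qed.

Lemma Re_idem1 xi : Re (idem1 xi) = bcRe xi + bcImj xi.
Proof. by case: xi => ? ? ? ?; rewrite /bcRe /bcImj /=; ring. Qed.
Lemma Re_idem2 xi : Re (idem2 xi) = bcRe xi - bcImj xi.
Proof. by case: xi => ? ? ? ?; rewrite /bcRe /bcImj /=; ring. Qed.

Lemma bcImj_lt_bcRe xi : `|bcImj xi| < bcRe xi ->
  0 < Re (idem1 xi) /\ 0 < Re (idem2 xi).
Proof. by rewrite ltr_norml Re_idem1 Re_idem2 => /andP[h1 h2]; split; lra. Qed.

Lemma rmorph_pochhammer (h : {rmorphism bicomplex R -> R[i]}) l (u : nat) :
  h (pochhammer l u) = pochhammer (h l) u.
Proof.
by rewrite /pochhammer rmorph_prod; apply: eq_bigr => k _; rewrite rmorphD rmorph_nat.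
Qed.

Lemma idem1_prabhakar_term m n l zeta (u : nat) :
  idem1 (prabhakar_term m n l zeta u) =
  complex_prabhakar_term (idem1 m) (idem1 n) (idem1 l) (idem1 zeta) u.
Proof.
rewrite /prabhakar_term !rmorphM/= rmorphXn/= rmorph_pochhammer/=.
by rewrite idem1_of_complex /bcrGamma idem1K rmorphD rmorphM rmorph_nat.
Qed.

Lemma idem2_prabhakar_term m n l zeta (u : nat) :
  idem2 (prabhakar_term m n l zeta u) =
  complex_prabhakar_term (idem2 m) (idem2 n) (idem2 l) (idem2 zeta) u.
Proof.
rewrite /prabhakar_term !rmorphM/= rmorphXn/= rmorph_pochhammer/=.
by rewrite idem2_of_complex /bcrGamma idem2K rmorphD rmorphM rmorph_nat.
Qed.

Lemma prabhakar_series m n l zeta : `|bcImj m| < bcRe m ->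
  bcseries_cvg (prabhakar_term m n l zeta) /\
  prabhakar m n l zeta = of_idem
    (complex_prabhakar (idem1 m) (idem1 n) (idem1 l) (idem1 zeta))
    (complex_prabhakar (idem2 m) (idem2 n) (idem2 l) (idem2 zeta)).
Proof.
move=> /bcImj_lt_bcRe[m1 m2].
have c1 := csummable_cvgo (@csummable_prabhakar R _ (idem1 n) (idem1 l) (idem1 zeta) m1).
have c2 := csummable_cvgo (@csummable_prabhakar R _ (idem2 n) (idem2 l) (idem2 zeta) m2).
rewrite -(funext (idem1_prabhakar_term m n l zeta)) in c1.
rewrite -(funext (idem2_prabhakar_term m n l zeta)) in c2.
split; first by split; apply/cvg_ex; eexists; [exact: c1|exact: c2].
rewrite /prabhakar /bcseries_sum; congr of_idem.
  rewrite /complex_prabhakar -(funext (idem1_prabhakar_term m n l zeta)).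
  exact: (cvg_lim (@norm_hausdorff _ _) c1).
rewrite /complex_prabhakar -(funext (idem2_prabhakar_term m n l zeta)).
exact: (cvg_lim (@norm_hausdorff _ _) c2).
Qed.

End IdempotentComponents.

Theorem theorem2p1 (R : realType) (a : R) (alpha m n l r : bicomplex R)
    (ha : 0 <= a)
    (halpha : `|bcImj alpha| < bcRe alpha)
    (hm : `|bcImj m| < bcRe m)
    (hn : `|bcImj n| < bcRe n)
    (x : R) (hx : a < x) :
  let f := fun t : R =>
    bcpow (t - a) (n - 1) * prabhakar m n l (r * bcpow (t - a) m) in
  let zeta := r * bcpow (x - a) m in
  [/\ bcseries_cvg (prabhakar_term m n l zeta),
      bcseries_cvg (prabhakar_term m (n + alpha) l zeta) &
      bcseries_cvg (prabhakar_term m (n - alpha) l zeta)] /\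
  (bcRL_integral_exists a alpha f x /\
   bcRL_integral a alpha f x =
     bcpow (x - a) (n + alpha - 1) * prabhakar m (n + alpha) l zeta) /\
  (bcRL_derivative_exists a alpha f x /\
   bcRL_derivative a alpha f x =
     bcpow (x - a) (n - alpha - 1) * prabhakar m (n - alpha) l zeta).
Proof.
move=> f zeta.
have [al1 al2] := bcImj_lt_bcRe halpha.
have [m1 m2] := bcImj_lt_bcRe hm; have [n1 n2] := bcImj_lt_bcRe hn.
have rhsE (s : bicomplex R) y :
    bcpow (y - a) (s - 1) * prabhakar m s l (r * bcpow (y - a) m) =
    of_idem
     (cpow (y - a) (idem1 s - 1) * complex_prabhakar (idem1 m) (idem1 s)
       (idem1 l) (idem1 r * cpow (y - a) (idem1 m)))
     (cpow (y - a) (idem2 s - 1) * complex_prabhakar (idem2 m) (idem2 s)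
       (idem2 l) (idem2 r * cpow (y - a) (idem2 m))).
  rewrite (prabhakar_series s l (r * bcpow (y - a) m) hm).2 /bcpow of_idemM.
  by rewrite !rmorphM/= idem1K idem2K !rmorphB/= !rmorph1.
have f1 t : a < t -> idem1 (f t) = cpow (t - a) (idem1 n - 1) *
    complex_prabhakar (idem1 m) (idem1 n) (idem1 l) (idem1 r * cpow (t - a) (idem1 m)).
  by move=> _; rewrite /f rhsE idem1K.
have f2 t : a < t -> idem2 (f t) = cpow (t - a) (idem2 n - 1) *
    complex_prabhakar (idem2 m) (idem2 n) (idem2 l) (idem2 r * cpow (t - a) (idem2 m)).
  by move=> _; rewrite /f rhsE idem2K.
have [i1 e1] := cRL_integral_prabhakar al1 m1 n1 hx f1.
have [i2 e2] := cRL_integral_prabhakar al2 m2 n2 hx f2.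
have [j1 d1] := cRL_derivative_prabhakar al1 m1 n1 hx f1.
have [j2 d2] := cRL_derivative_prabhakar al2 m2 n2 hx f2.
split; first by split; exact: (prabhakar_series _ _ _ hm).1.
split; split; try by split.
  by rewrite rhsE !rmorphD /bcRL_integral e1 e2.
by rewrite rhsE !rmorphB /bcRL_derivative d1 d2.
Qed.
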